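(* For every integer $m\ge0$, $\mathcal{V}_{\boldsymbol\Gamma}(\Omega)\cap\mathcal{H}^m_{\boldsymbol\Gamma}(\Omega)$ is dense in $\mathcal{H}^m_{\boldsymbol\Gamma}(\Omega)$.
   Context: $\Omega=(0,L_1)\times(0,L_2)$ with $L_1,L_2>0$; ${\boldsymbol\Gamma}=\{x=0\}\cup\{y=0\}$ (the corresponding two sides of $\Omega$); $\theta|_{\boldsymbol\Gamma}=0$ means $\theta|_{x=0}=\theta|_{y=0}=0$; $\partial^\alpha=\partial_x^{\alpha_1}\partial_y^{\alpha_2}$, $|\alpha|=\alpha_1+\alpha_2$. $$\mathcal{H}^m_{\boldsymbol\Gamma}(\Omega)=\{\theta\in H^m(\Omega):\ \partial^\alpha\theta|_{\boldsymbol\Gamma}=0\ \ \forall\,|\alpha|\le m-1\}$$ with the norm of $H^m(\Omega)$ (so $\mathcal{H}^0_{\boldsymbol\Gamma}(\Omega)=L^2(\Omega)$), and $$\mathcal{V}_{\boldsymbol\Gamma}(\Omega)=\{\theta\in\mathcal{C}^\infty(\overline\Omega):\ \theta\text{ vanishes in a neighborhood of }{\boldsymbol\Gamma}\}.$$ *)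

(* Defs.v *)
From mathcomp Require Import all_boot all_order all_algebra.
From mathcomp Require Import all_classical all_reals all_analysis.
Import Order.TTheory GRing.Theory Num.Theory.
Import numFieldNormedType.Exports.

Set Implicit Arguments.
Unset Strict Implicit.
Unset Printing Implicit Defensive.

Local Open Scope classical_set_scope.
Local Open Scope ring_scope.

Section Smooth.
Variable R : realType.
Implicit Types (f : R * R -> R) (a : nat * nat).

Definition dx f : R * R -> R := fun p => 'D_((1, 0) : R * R) f p.
Definition dy f : R * R -> R := fun p => 'D_((0, 1) : R * R) f p.

Definition pd a f : R * R -> R := iter a.1 dx (iter a.2 dy f).

Fixpoint Ck k f : Prop :=
  continuous f /\
  if k is k'.+1 then
    [/\ forall p, derivable f p ((1, 0) : R * R),
        forall p, derivable f p ((0, 1) : R * R),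
        Ck k' (dx f) & Ck k' (dy f)]
  else True.

Definition smooth f : Prop := forall k, Ck k f.

(* C^oo(closure of O): restrictions to the closure of smooth functions on the
   plane. The values of f outside the closure of O are irrelevant. *)
Definition smooth_closure (O : set (R * R)) f : Prop :=
  exists2 g, smooth g & forall p, closure O p -> f p = g p.

Definition test_function (O : set (R * R)) f : Prop :=
  smooth f /\ exists K : set (R * R),
    [/\ compact K, K `<=` O & forall p, ~ K p -> f p = 0].

End Smooth.

(* Elements of L^2(A) and H^m(O) are represented by functions on the whole line
   or plane, of which only the values on A or O matter: u \_ A is u extended
   by 0 outside of A. *)
Section L2.
Context d (T : measurableType d) (R : realType).
Variable mu : {measure set T -> \bar R}.

Definition L2 (A : set T) (u : T -> R) : Prop := (u \_ A) \in Lfun mu 2%:E.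

Definition L2norm (A : set T) (u : T -> R) : \bar R :=
  'N[mu]_(2%:E)[EFin \o (u \_ A)]%E.

End L2.

Section SobolevSpaces.
Variable R : realType.
Variable O : set (R * R).
Implicit Types (u v f : R * R -> R) (a : nat * nat).

Definition mu1 : {measure set (measurableTypeR R) -> \bar R} :=
  @lebesgue_measure R.

Definition mu2 :
    {measure set (measurableTypeR R * measurableTypeR R)%type -> \bar R} :=
  (@lebesgue_measure R \x @lebesgue_measure R)%E.

(* v is the weak derivative of order a of u, both functions being in L^2(O) *)
Definition is_weak_deriv a u v : Prop :=
  [/\ L2 mu2 O u, L2 mu2 O v & forall f, test_function O f ->
    \int[mu2]_(p in O) (u p * pd a f p) =
    (-1) ^+ (a.1 + a.2) * \int[mu2]_(p in O) (v p * f p)].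

(* The weak derivative, which is unique up to equality a.e. on O; it is 0 by
   convention if there is none. *)
Definition wd a u : R * R -> R := xget (fun=> 0) [set v | is_weak_deriv a u v].

(* For m = 0, the only condition is that u is in L^2(O) (take v = u). *)
Definition Sobolev (m : nat) : set (R * R -> R) :=
  [set u | forall a, (a.1 + a.2 <= m)%N -> exists v, is_weak_deriv a u v].

Definition Hnorm (m : nat) u : \bar R :=
  ((\sum_(i < m.+1) \sum_(j < m.+1 | (i + j <= m)%N)
      L2norm mu2 O (wd (nat_of_ord i, nat_of_ord j) u) ^+ 2) `^ 2^-1)%E.

(* g in L^2(I) is the trace of u in H^1(O) on the side parametrized by
   gam : I -> closure of O, the trace operator being the extension by continuity
   of the restriction of functions in C^oo(closure of O). *)
Definition is_trace (gam : R -> R * R) (I : set R) u (g : R -> R) : Prop :=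
  [/\ Sobolev 1 u, L2 mu1 I g & exists f : nat -> R * R -> R,
    [/\ forall n, smooth_closure O (f n),
        Hnorm 1 (f n \- u) @[n --> \oo] --> 0%E &
        L2norm mu1 I ((f n \o gam) \- g) @[n --> \oo] --> 0%E]].

End SobolevSpaces.

Section Rectangle.
Variable R : realType.
Variables l1 l2 : R.
Implicit Types (u : R * R -> R).

Definition Omega : set (R * R) := `]0, l1[%classic `*` `]0, l2[%classic.

Definition Gamma : set (R * R) :=
  closure Omega `&` [set p | p.1 = 0 \/ p.2 = 0].

Definition trace0 u : Prop :=
  is_trace Omega (fun y => (0, y)) `]0, l2[%classic u (fun=> 0) /\
  is_trace Omega (fun x => (x, 0)) `]0, l1[%classic u (fun=> 0).

(* |a| < m is |a| <= m - 1, with no condition for m = 0. *)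
Definition HGamma (m : nat) : set (R * R -> R) :=
  [set u | Sobolev Omega m u /\
    forall a, (a.1 + a.2 < m)%N -> trace0 (wd Omega a u)].

Definition VGamma : set (R * R -> R) :=
  [set u | smooth_closure Omega u /\
    exists U : set (R * R), [/\ open U, Gamma `<=` U &
      forall p, U p -> closure Omega p -> u p = 0]].

End Rectangle.

(* A is a dense subset of B for the distance (u, v) |-> N (u - v). *)
Definition dense_subset (R : realType) (N : (R * R -> R) -> \bar R)
    (A B : set (R * R -> R)) : Prop :=
  A `<=` B /\ forall u, B u -> forall e : R, 0 < e ->
    exists2 v, A v & (N (u \- v)%R < e%:E)%E.

(* Main.v *)
(* Traces of order less than m vanish on Gamma, so that the extension of u by
   zero across Gamma has no jump there. Let k be a bump function supported in
   [e, 2 e], and let v be the convolution of u, extended by zero to the plane,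
   with the one-sided kernel k(x) k(y): at p, it only involves the values of u to
   the left of and below p. Then v is smooth and vanishes for x < e and for y < e.
   At p in Omega, the kernel centered at p vanishes on the two other sides of
   Omega, and u has zero traces on Gamma, so that integration by parts has no
   boundary term: for |a| <= m, the derivative of v of order a is the convolution
   of the weak derivative of u with the kernel. As e tends to 0, it tends to this
   weak derivative in L^2. The approximation property is proved for rectangles,
   then for bounded sets by a Dynkin class argument, and extended to L^2 because
   averaging is a contraction of L^2. *)
Require Import Defs.
From HB Require Import structures.
From mathcomp Require Import all_boot all_order all_algebra.
From mathcomp Require Import all_classical all_reals all_analysis.
From mathcomp Require Import measurable_realfun ring lra.
Import Order.TTheory GRing.Theory Num.Theory.
Import numFieldNormedType.Exports.

Set Implicit Arguments.
Unset Strict Implicit.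
Unset Printing Implicit Defensive.

Local Open Scope classical_set_scope.
Local Open Scope ring_scope.

(** * Bump functions *)

(** The weak derivative [wd] is an arbitrary choice in its class, and a zero trace is known only
    through smooth functions that approximate in H^1. Equality almost everywhere is therefore
    handled as vanishing energy of a difference, and uniqueness of weak derivatives is proved from
    the same averages that give the approximation. The kernel at a point of Omega is in general no
    test function, as its support may cross Gamma: the definition of weak derivatives does not apply
    to it, and derivatives are moved one at a time, each through the trace of a weak derivative of
    lower order. Those in x are moved before those in y, following [pd], so that partial derivatives
    never have to commute. The one-sided kernel also dictates the half-open rectangles: averages of
    their indicators converge at every point, edges included, which is all that the L^2 theory
    starts from. Derivatives under the integral sign come from Taylor bounds uniform on the plane,
    not from a limit theorem. *)

Section derivatives.
Variable R : realType.
Implicit Types (x y h C : R) (f g : R -> R).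

(** A remainder bound valid for all [h], and not only near 0, survives integration over a parameter:
    this is how convolutions get their derivatives. It also settles the point 0 in
    [is_derive_flat]. *)
Lemma derive_quadratic (V : normedModType R) (f : V -> R) (p v : V) (l C : R) :
  (forall h, `|f (h *: v + p) - f p - h * l| <= C * h ^+ 2) ->
  is_derive p v f l.
Proof.
move=> fC.
have C0 : 0 <= C by have := fC 1; rewrite expr1n mulr1; apply: le_trans.
have cf : h^-1 *: (f (h *: v + p) - f p) @[h --> 0^'] --> l.
  apply/cvgrPdist_le => e e0; near=> h.
  have h0 : h != 0 by near: h; exact: nbhs_dnbhs_neq.
  have hl : `|h| <= e / (C + 1).
    near: h; apply: dnbhs0_le.
    by rewrite divr_gt0// ltr_wpDl.
  have -> : l - h^-1 *: (f (h *: v + p) - f p) = - (h^-1 * (f (h *: v + p) - f p - h * l)).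
    by rewrite /GRing.scale/=; field.
  rewrite normrN normrM normfV ler_pdivrMl ?normr_gt0//.
  apply: le_trans (fC h) _; rewrite -(real_normK (num_real h)).
  have : C * `|h| <= e.
    apply: (@le_trans _ _ (C * (e / (C + 1)))); first exact: ler_wpM2l.
    by rewrite mulrCA ger_pMr// ler_pdivrMr ?mul1r ?lerDl// ltr_wpDl.
  have := normr_ge0 h; nra.
apply: DeriveDef; first by apply/cvg_ex; exists l.
by apply/cvg_lim => //.
Unshelve. all: by end_near. Qed.

Lemma derive_MVT f g x y : (forall z : R, is_derive z (1 : R) f (g z)) ->
  exists2 c, `|c - x| <= `|y - x| & f y - f x = g c * (y - x).
Proof.
move=> fg.
have H u v : u < v -> exists2 c, u < c < v & f v - f u = g c * (v - u).
  move=> uv; have cf : {within `[u, v], continuous f}.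
    by apply: derivable_within_continuous => z _; exact: ex_derive.
  have [c cuv fE] := @MVT _ f g _ _ uv (fun z _ => fg z) cf.
  by exists c.
case: (ltrgtP x y) => [xy|yx|->].
- have [c /andP[xc cy] ->] := H _ _ xy; exists c => //.
  by rewrite ger0_norm ?subr_ge0 ?(ltW xc)// lerD2r ltW.
- have [c /andP[yc cx] E] := H _ _ yx; exists c.
    by rewrite ler0_norm ?subr_le0 ?(ltW cx)// opprB lerD2l lerN2 ltW.
  by rewrite -opprB E -mulrN opprB.
- by exists y; rewrite ?subrr ?normr0 ?mulr0.
Qed.

Lemma derive_lipschitz f g M x y :
  (forall z : R, is_derive z (1 : R) f (g z)) -> (forall z, `|g z| <= M) ->
  `|f y - f x| <= M * `|y - x|.
Proof.
move=> fg gM; have [c _ ->] := derive_MVT x y fg.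
by rewrite normrM ler_wpM2r.
Qed.

(** Mean value theorem for [f], then the Lipschitz bound for [g] between [x] and the intermediate
    point. The factor 1/2 of Taylor's formula is given up. *)
Lemma derive_taylor f g k M x h :
  (forall z : R, is_derive z (1 : R) f (g z)) ->
  (forall z : R, is_derive z (1 : R) g (k z)) ->
  (forall z, `|k z| <= M) -> `|f (x + h) - f x - h * g x| <= M * h ^+ 2.
Proof.
move=> fg gk kM.
have [c cx ->] := derive_MVT x (x + h) fg.
have -> : x + h - x = h by ring.
rewrite (mulrC h) -mulrBl normrM.
rewrite (_ : x + h - x = h) in cx; last by ring.
rewrite -(real_normK (num_real h)) expr2 mulrA ler_wpM2r//.
apply: le_trans (derive_lipschitz _ _ gk kM) _; rewrite ler_wpM2l//.
exact: le_trans (kM x).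
Qed.

End derivatives.

Section bump.
Variable R : realType.
Implicit Types (x y e : R) (f g : R -> R) (n i j : nat).

(** The power of [1 / x] is a parameter so that the derivative of each member is a combination of
    others; no polynomial in [1 / x] has to be described. *)
Definition flat n x : R := if 0 < x then x ^- n * expR (- x^-1) else 0.

Lemma flat_ge0 n x : 0 <= flat n x.
Proof.
rewrite /flat; case: ifP => // x0.
by rewrite mulr_ge0 ?expR_ge0 ?invr_ge0 ?exprn_ge0 ?ltW.
Qed.

Lemma flatS n x : flat n.+1 x * x = flat n x.
Proof.
rewrite /flat; case: ifP => [x0|]; last by rewrite mul0r.
by rewrite exprSr; field; rewrite gt_eqF ?exprn_gt0//= gt_eqF.
Qed.

(* From [t ^ n / n`! <= exp t] with [t = 1 / x]. *)
Lemma flat_le n x : flat n x <= n`!%:R.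
Proof.
rewrite /flat; case: ifP => [x0|_]; last exact: ler0n.
rewrite expRN ler_pdivrMr ?expR_gt0//.
case: n => [|n].
  rewrite expr0 invr1 fact0 mul1r -expR0 ler_expR invr_ge0 ltW//.
have := @expR_ge1Dxn R x^-1 n; rewrite invr_ge0 (ltW x0) => /(_ isT) h.
rewrite -exprVn mulrC -ler_pdivrMr ?ltr0n ?fact_gt0//.
by apply: le_trans h; rewrite lerDr.
Qed.

Lemma flat_norm_le n x : `|flat n x| <= n`!%:R.
Proof. by rewrite ger0_norm ?flat_le ?flat_ge0. Qed.

Lemma is_derive_flat n x :
  is_derive x (1 : R) (flat n) (flat n.+2 x - n%:R * flat n.+1 x).
Proof.
case: (ltrgtP x 0) => [x0|x0|->].
- rewrite /flat !ltNge (ltW x0)/= mulr0 subr0.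
  apply: (@near_eq_is_derive _ _ _ (cst 0)).
  near=> y; rewrite ltNge (_ : y <= 0)//.
  by apply: ltW; near: y; exact: lt_nbhsl.
- have xN0 : x != 0 by rewrite gt_eqF.
  apply: (@near_eq_is_derive _ _ _ (fun y => (y^-1) ^+ n * expR (- y^-1))).
    near=> y; rewrite /flat (_ : 0 < y) ?exprVn//.
    by near: y; exact: lt_nbhsr.
  have dV : is_derive x (1 : R) (fun y => y^-1) (- x ^- 2).
    have := @is_deriveV R id x 1 1 xN0 (is_derive_id _ _).
    by rewrite /GRing.scale/= mulr1.
  have dN : is_derive x (1 : R) (fun y => - y^-1) (x ^- 2).
    by have := is_deriveN dV; rewrite opprK.
  have dE : is_derive x (1 : R) (fun y => expR (- y^-1)) (expR (- x^-1) * x ^- 2).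
    by have := @is_derive1_comp R expR (fun y => - y^-1) x _ _ (is_derive_expR _) dN.
  have dX := is_deriveX n dV.
  rewrite (_ : _ ^+ n = (fun y => (y^-1) ^+ n)) in dX; last first.
    by apply/funext => y; rewrite exprfctE.
  have D : is_derive x (1 : R) (fun y => (y^-1) ^+ n * expR (- y^-1)) _ :=
    is_deriveM dX dE.
  apply: (is_derive_eq D).
  rewrite /flat x0 /GRing.scale/=.
  case: n {dX D} => [|n].
    by rewrite !mul0r !mulr0 addr0 subr0 expr0; field.
  rewrite -pred_Sn !exprVn (exprS x n.+2) (exprS x n.+1) (exprS x n); field.
  by rewrite expf_neq0.
- have f0 k : flat k 0 = 0 by rewrite /flat ltxx.
  rewrite !f0 mulr0 subr0.
  (* At 0, [flat n h = flat n.+2 h * h ^+ 2] with a bounded first factor: the remainder is quadratic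
     and the derivative is 0. *)
  apply: (@derive_quadratic _ R^o _ _ _ _ (n.+2)`!%:R) => h.
  rewrite /GRing.scale/= mulr1 addr0 mulr0 subr0 f0 subr0.
  rewrite -flatS -flatS -mulrA -expr2 normrM (@ger0_norm _ (_ ^+ 2)) ?sqr_ge0//.
  by rewrite ler_wpM2r ?sqr_ge0 ?flat_norm_le.
Unshelve. all: by end_near. Qed.

(* A class of functions stable under derivation. *)
Inductive bumps e : (R -> R) -> Prop :=
| bumps_flat i j : bumps e (fun x => flat i (x - e) * flat j (2 * e - x))
| bumpsD f g : bumps e f -> bumps e g -> bumps e (fun x => f x + g x)
| bumpsZ c f : bumps e f -> bumps e (fun x => c * f x).

Lemma bumps_derive e f : bumps e f ->
  exists2 g, bumps e g & forall x, is_derive x (1 : R) f (g x).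
Proof.
elim=> [i j|{}f g _ [f' bf' ff'] _ [g' bg' gg']|c {}f _ [f' bf' ff']].
- pose F i j x := flat i (x - e) * flat j (2 * e - x).
  exists (fun x => (F i.+2 j x + (- i%:R) * F i.+1 j x) +
    ((-1) * F i j.+2 x + j%:R * F i j.+1 x)).
    by do !(apply: bumpsD || apply: bumpsZ || apply: bumps_flat).
  move=> x.
  have d1 : is_derive x (1 : R) (fun y => y - e) 1.
    by have := is_deriveB (is_derive_id x (1 : R)) (is_derive_cst e x (1 : R)); rewrite subr0.
  have d2 : is_derive x (1 : R) (fun y => 2 * e - y) (-1).
    by have := is_deriveB (is_derive_cst (2 * e) x (1 : R)) (is_derive_id x (1 : R)); rewrite sub0r.
  have D1 := @is_derive1_comp R (flat i) _ x _ _ (is_derive_flat i (x - e)) d1.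
  have D2 := @is_derive1_comp R (flat j) _ x _ _ (is_derive_flat j (2 * e - x)) d2.
  have D : is_derive x (1 : R) (fun x0 => flat i (x0 - e) * flat j (2 * e - x0)) _ :=
    is_deriveM D1 D2.
  apply: (is_derive_eq D).
  by rewrite /GRing.scale/= /F; ring.
- exists (fun x => f' x + g' x); first exact: bumpsD.
  by move=> x; exact: (is_deriveD (ff' x) (gg' x)).
- exists (fun x => c * f' x); first exact: bumpsZ.
  by move=> x; exact: (is_deriveZ c (ff' x)).
Qed.

Lemma bumps_bounded e f : bumps e f -> exists M, forall x, `|f x| <= M.
Proof.
elim=> [i j|{}f g _ [M fM] _ [N gN]|c {}f _ [M fM]].
- exists (i`!%:R * j`!%:R) => x; rewrite normrM.
  by apply: ler_pM => //; exact: flat_norm_le.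
- by exists (M + N) => x; apply: le_trans (ler_normD _ _) (lerD _ _).
- by exists (`|c| * M) => x; rewrite normrM ler_wpM2l.
Qed.

(** Proved for the whole class, hence available for all derivatives of a bump. *)
Lemma bumps_support e f x : bumps e f -> f x != 0 -> e <= x <= 2 * e.
Proof.
move=> bf; apply: contraNT; rewrite negb_and -!ltNge => /orP ex; apply/eqP.
elim: bf => [i j|{}f g _ -> _ ->|c {}f _ ->]; rewrite ?mulr0 ?addr0//.
rewrite /flat subr_gt0 subr_gt0; case: ex => ex.
  by rewrite ltNge (ltW ex)/= mul0r.
by rewrite [X in _ * X]ifF ?mulr0//; apply/negbTE; rewrite -leNgt ltW.
Qed.

(* The successive derivatives of [a 0]. *)
Record jet (a : nat -> R -> R) : Prop := Jet {
  jet_derive : forall n x, is_derive x (1 : R) (a n) (a n.+1 x);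
  jet_bounded : forall n, exists M, forall x, `|a n x| <= M }.

Lemma bumps_jet e f : bumps e f -> exists2 a, jet a &
  a 0%N = f /\ forall n, bumps e (a n).
Proof.
move=> bf; pose a n := iter n (@derive1 _ _) f : R -> R.
have bd g : bumps e g -> bumps e (derive1 g) /\
    forall x, is_derive x (1 : R) g (derive1 g x).
  move=> /bumps_derive[g' bg' gg'].
  have -> : derive1 g = g' by apply/funext => x; rewrite derive1E derive_val.
  by [].
have ba n : bumps e (a n).
  by elim: n => [//|n bn]; rewrite /a iterS; exact: (bd _ bn).1.
exists a => //; split=> n; first exact: (bd _ (ba n)).2.
exact: bumps_bounded (ba n).
Qed.

Lemma jet_continuous a n : jet a -> continuous (a n).
Proof.
move=> ja x; apply/differentiable_continuous/derivable1_diffP.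
by case: (jet_derive ja n x).
Qed.

Local Notation leb := (@lebesgue_measure R).

Lemma ge0_integral_translate f x : continuous f -> (forall y, 0 <= f y) ->
  (\int[leb]_y (f (y - x))%:E = \int[leb]_y (f y)%:E)%E.
Proof.
move=> cf f0; have dF y : is_derive y (1 : R) (fun y => y - x) 1.
  by have := is_deriveB (is_derive_id y (1 : R)) (is_derive_cst x y (1 : R)); rewrite subr0.
have F1 : derive1 (fun y : R => y - x) = cst 1.
  by apply/funext => y; rewrite derive1E derive_val.
rewrite (@increasing_ge0_integration_by_substitutionT _ (fun y => y - x) f)//.
- by apply: eq_integral => y _; rewrite F1 mulr1.
- by move=> y z yz; rewrite ltrD2r.
- by rewrite F1 => y; exact: cvg_cst.
- by rewrite F1; exact: is_cvg_cst.
- by rewrite F1; exact: is_cvg_cst.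
- exact: cvg_addrr_Ny.
- exact: cvg_addrr.
Qed.

Lemma ge0_integral_reflect f x : continuous f -> (forall y, 0 <= f y) ->
  (\int[leb]_y (f (x - y))%:E = \int[leb]_y (f y)%:E)%E.
Proof.
move=> cf f0.
have cg : continuous (fun y => f (- y)).
  by move=> y; apply: continuous_comp; [exact: opp_continuous|exact: cf].
transitivity (\int[leb]_y (f (- y))%:E)%E.
  rewrite -(@ge0_integral_translate (fun y => f (- y)) x)//.
  by apply: eq_integral => y _; rewrite opprB.
have mN : measurable_fun setT (-%R : measurableTypeR R -> measurableTypeR R).
  exact: oppr_measurable.
have := @ge0_integral_pushforward _ _ _ _ R _ mN leb setT (EFin \o f) measurableT.
rewrite preimage_setT => <-//.
- apply: eq_measure_integral => /= A mA _; exact: lebesgue_measureN.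
- by apply/measurable_EFinP; exact: continuous_measurable_fun.
- by move=> y _; rewrite lee_fin.
Qed.

Lemma exists_mollifier e : 0 < e -> exists a : nat -> R -> R,
  [/\ jet a, forall n x, a n x != 0 -> e <= x <= 2 * e,
     forall x, 0 <= a 0%N x & (\int[leb]_y (a 0%N y)%:E = 1)%E].
Proof.
move=> e0; pose f x := flat 0 (x - e) * flat 0 (2 * e - x).
have bf : bumps e f by exact: bumps_flat.
have f0 x : 0 <= f x by rewrite mulr_ge0 ?flat_ge0.
have cf : continuous f.
  by have [a ja [<- _]] := bumps_jet bf; exact: jet_continuous.
have mf : measurable_fun setT (EFin \o f).
  by apply/measurable_EFinP; exact: continuous_measurable_fun.
pose c := fine (\int[leb]_x (f x)%:E)%E.
have ioo : (\int[leb]_x (f x)%:E < +oo)%E.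
  have [M fM] := bumps_bounded bf.
  apply: (@le_lt_trans _ _ (\int[leb]_(x in `[e, (2 * e)%R]) (cst M%:E x))%E).
    rewrite [leRHS]integral_mkcond; apply: ge0_le_integral => //.
    - by move=> x _; rewrite lee_fin.
    - by apply/(measurable_restrictT _ _).1.
    - move=> x _; rewrite patchE; case: ifPn => [_|].
        by rewrite lee_fin (le_trans _ (fM x))// ler_norm.
      apply: contraNT; rewrite -ltNge lte_fin => fx; rewrite inE/= in_itv/=.
      by apply: (bumps_support bf); rewrite gt_eqF.
  by rewrite integral_cst//= lebesgue_measure_itv/=; case: ifP => _; rewrite -?EFinB -?EFinM ?mule0 ltry.
have c0 : 0 < c.
  (* On the middle half [[5 e / 4, 7 e / 4]], of length [e / 2], both arguments of [flat 0] are at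
     least [e / 4]. Since [flat 0] increases, [f] is at least [m] there. *)
  pose m : R := expR (- (4^-1 * e)^-1) * expR (- (4^-1 * e)^-1).
  have m0 : 0 < m by rewrite mulr_gt0 ?expR_gt0.
  have : ((m * (e / 2))%:E <= \int[leb]_x (f x)%:E)%E.
    apply: (@le_trans _ _ (\int[leb]_(x in `[(5 / 4 * e)%R, (7 / 4 * e)%R]) (cst m%:E x))%E).
      rewrite integral_cst//= lebesgue_measure_itv/= lte_fin ifT; last by lra.
      by rewrite -EFinB -EFinM lee_fin ler_wpM2l ?(ltW m0)//; lra.
    rewrite integral_mkcond; apply: ge0_le_integral => //.
    - by move=> x _; rewrite patchE; case: ifPn; rewrite // lee_fin ltW.
    - by apply/(measurable_restrictT _ _).1.
    - move=> x _; rewrite patchE; case: ifPn => [|_]; last by rewrite lee_fin.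
      rewrite inE/= in_itv/= lee_fin => /andP[x1 x2].
      have k0 : 0 < 4^-1 * e by lra.
      rewrite /f /flat !ifT; try lra.
      rewrite !expr0 invr1 !mul1r; apply: ler_pM; rewrite ?expR_ge0//.
        by rewrite ler_expR lerN2 lef_pV2 ?posrE; lra.
      by rewrite ler_expR lerN2 lef_pV2 ?posrE; lra.
  rewrite -[X in (_ <= X)%E]fineK; last by rewrite ge0_fin_numE// integral_ge0// => x _; rewrite lee_fin.
  by rewrite lee_fin; apply: lt_le_trans; rewrite mulr_gt0// divr_gt0.
have [a ja [a0 ba]] := bumps_jet (bumpsZ c^-1 bf).
exists a; split=> //.
- by move=> n x; exact: bumps_support.
- by move=> x; rewrite a0 mulr_ge0// invr_ge0 ltW.
- rewrite a0; under eq_integral do rewrite EFinM.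
  rewrite ge0_integralZl//.
  + rewrite -[X in (_ * X)%E]fineK; last by rewrite ge0_fin_numE// integral_ge0// => x _; rewrite lee_fin.
    by rewrite -/c -EFinM mulVf// gt_eqF.
  + by move=> x _; rewrite lee_fin.
  + by rewrite lee_fin invr_ge0 ltW.
Qed.

End bump.

(** * Averaging kernels and approximate identities *)

Lemma cvge0_lt (R : realType) (u : nat -> \bar R) (e : R) : 0 < e ->
  u n @[n --> \oo] --> 0%E -> \forall n \near \oo, (u n < e%:E)%E.
Proof.
move=> e0 /fine_cvgP[uf /cvgr_lt/(_ e e0)]; apply: filterS2 uf => n un /= ne.
by rewrite -(fineK un) lte_fin.
Qed.

(** * Squared L^2 norms *)

Section energy.
Context d (T : measurableType d) (R : realType).
Variable mu : {measure set T -> \bar R}.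
Implicit Types (f g : T -> R) (c : R).

(** Without the square root, L^2 estimates are integrals of pointwise inequalities; the price is the
    factor 2 of [energyD] in place of the triangle inequality. *)
Definition energy f : \bar R := (\int[mu]_x (f x ^+ 2)%:E)%E.

Definition sqint f := measurable_fun setT f /\ (energy f < +oo)%E.

Lemma energy_ge0 f : (0 <= energy f)%E.
Proof. by apply: integral_ge0 => x _; rewrite lee_fin sqr_ge0. Qed.

Lemma measurable_sqr f : measurable_fun setT f ->
  measurable_fun setT (fun x => (f x ^+ 2)%:E).
Proof. by move=> mf; apply/measurable_EFinP; exact: measurable_funX. Qed.

Lemma sqint_integrable f : sqint f ->
  mu.-integrable setT (fun x => (f x ^+ 2)%:E).
Proof.
move=> [mf foo]; apply/integrableP; split; first exact: measurable_sqr.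
by under eq_integral do rewrite gee0_abs ?lee_fin ?sqr_ge0//.
Qed.

Lemma le_energy f g : measurable_fun setT f -> measurable_fun setT g ->
  (forall x, `|f x| <= `|g x|) -> (energy f <= energy g)%E.
Proof.
move=> mf mg fg; apply: ge0_le_integral => //.
- by move=> x _; rewrite lee_fin sqr_ge0.
- exact: measurable_sqr.
- exact: measurable_sqr.
- move=> x _; rewrite lee_fin -(real_normK (num_real (f x))).
  by rewrite -(real_normK (num_real (g x))) lerXn2r ?nnegrE.
Qed.

Lemma energyZ c f : measurable_fun setT f ->
  (energy (fun x => c * f x)%R = (c ^+ 2)%:E * energy f)%E.
Proof.
move=> mf; rewrite /energy -ge0_integralZl//.
- by apply: eq_integral => x _; rewrite exprMn EFinM.
- exact: measurable_sqr.
- by move=> x _; rewrite lee_fin sqr_ge0.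
- by rewrite lee_fin sqr_ge0.
Qed.

Lemma energyN f : energy (fun x => - f x) = energy f.
Proof. by apply: eq_integral => x _; rewrite sqrrN. Qed.

(** Integrate [(f + g)^2 <= 2 (f^2 + g^2)], that is, [(f - g)^2 >= 0]. *)
Lemma energyD f g : measurable_fun setT f -> measurable_fun setT g ->
  (energy (fun x => f x + g x)%R <= 2%:E * (energy f + energy g))%E.
Proof.
move=> mf mg; rewrite /energy -ge0_integralD//; last 4 first.
- by move=> x _; rewrite lee_fin sqr_ge0.
- exact: measurable_sqr.
- by move=> x _; rewrite lee_fin sqr_ge0.
- exact: measurable_sqr.
rewrite -ge0_integralZl//; last 2 first.
- by apply: emeasurable_funD; exact: measurable_sqr.
- by move=> x _; rewrite adde_ge0// lee_fin sqr_ge0.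
apply: ge0_le_integral => //.
- by move=> x _; rewrite lee_fin sqr_ge0.
- by apply/measurable_sqr/measurable_funD.
- by apply: emeasurable_funM => //; apply: emeasurable_funD; exact: measurable_sqr.
move=> x _; rewrite lee_fin.
have := sqr_ge0 (f x - g x); nra.
Qed.

Lemma energyB f g : measurable_fun setT f -> measurable_fun setT g ->
  (energy (fun x => f x - g x)%R <= 2%:E * (energy f + energy g))%E.
Proof.
move=> mf mg; rewrite -(energyN g); apply: energyD => //.
exact: measurable_funN.
Qed.

Lemma sqintD f g : sqint f -> sqint g -> sqint (fun x => f x + g x).
Proof.
move=> [mf fo] [mg go]; split; first exact: measurable_funD.
apply: le_lt_trans (energyD mf mg) _.
by rewrite lte_mul_pinfty// lte_add_pinfty.
Qed.

Lemma sqintZ c f : sqint f -> sqint (fun x => c * f x).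
Proof.
move=> [mf fo]; split; first exact: measurable_funM.
by rewrite energyZ// lte_mul_pinfty// lee_fin sqr_ge0.
Qed.

Lemma sqintN f : sqint f -> sqint (fun x => - f x).
Proof. by move=> [mf fo]; split; [exact: measurable_funN|rewrite energyN]. Qed.

Lemma sqintB f g : sqint f -> sqint g -> sqint (fun x => f x - g x).
Proof. by move=> sf sg; apply: sqintD => //; exact: sqintN. Qed.

Lemma sqint_integrableM f g : sqint f -> sqint g ->
  mu.-integrable setT (fun x => (f x * g x)%:E).
Proof.
move=> sf sg.
apply: (le_integrable _ _ _ (integrableD _ (sqint_integrable sf) (sqint_integrable sg))) => //.
  by apply/measurable_EFinP; apply: measurable_funM; [case: sf|case: sg].
move=> x _ /=; rewrite lee_fin [leRHS]ger0_norm ?addr_ge0 ?sqr_ge0//.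
rewrite ler_norml; apply/andP; split.
  by have := sqr_ge0 (f x + g x); have := sqr_ge0 (f x); have := sqr_ge0 (g x); nra.
by have := sqr_ge0 (f x - g x); have := sqr_ge0 (f x); have := sqr_ge0 (g x); nra.
Qed.

Lemma sqint_indic (A : set T) : measurable A -> (mu A < +oo)%E -> sqint \1_A.
Proof.
move=> mA Aoo; split; first exact: measurable_indic.
rewrite /energy (eq_integral (EFin \o \1_A)) => [|x _].
  by rewrite integral_indic// setIT.
by rewrite /= indicE; case: (x \in A); rewrite ?expr0n ?expr1n.
Qed.

Lemma energy_indic (A : set T) : measurable A -> energy \1_A = mu A.
Proof.
move=> mA; rewrite /energy (eq_integral (EFin \o \1_A)) => [|x _].
  by rewrite integral_indic// setIT.
by rewrite /= indicE; case: (x \in A); rewrite ?expr0n ?expr1n.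
Qed.

End energy.

(** * Contraction of L^2 by kernels of mass 1 in each variable *)

Section averaging.
Context d (T : measurableType d) (R : realType).
Variable mu : {sigma_finite_measure set T -> \bar R}.
Implicit Types (K : T -> T -> R) (f g : T -> R).

(** Mass 1 in [y] makes averages means, to which Jensen's inequality applies; mass 1 in [x] is what
    Tonelli's theorem needs for the contraction. Boundedness puts [K x] in L^2, so that averages of
    square integrable functions are convergent integrals. *)
Record averaging K : Prop := Averaging {
  averaging_ge0 : forall x y, 0 <= K x y;
  averaging_measurable : measurable_fun setT (fun z => K z.1 z.2);
  averaging_bounded : exists M, forall x y, K x y <= M;
  averaging_int1 : forall x, (\int[mu]_y (K x y)%:E = 1)%E;
  averaging_int2 : forall y, (\int[mu]_x (K x y)%:E = 1)%E }.

Definition average K f x : R := \int[mu]_y (K x y * f y).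

Variable K : T -> T -> R.
Hypothesis aK : averaging K.

Lemma averaging_measurable1 x : measurable_fun setT (K x).
Proof.
have := averaging_measurable aK.
by move=> /(measurableT_comp)/(_ (pair1_measurable x)).
Qed.

Lemma averaging_sqint x : sqint mu (K x).
Proof.
split; first exact: averaging_measurable1.
have [M KM] := averaging_bounded aK.
have M0 : 0 <= M by apply: le_trans (KM x x); exact: averaging_ge0.
apply: (@le_lt_trans _ _ (\int[mu]_y (M%:E * (K x y)%:E))%E).
  apply: ge0_le_integral => //.
  - by move=> y _; rewrite lee_fin sqr_ge0.
  - exact/measurable_sqr/averaging_measurable1.
  - by apply/measurable_EFinP/measurable_funM => //; exact: averaging_measurable1.
  - by move=> y _; rewrite -EFinM lee_fin expr2 ler_wpM2r// averaging_ge0.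
rewrite ge0_integralZl//.
- by rewrite averaging_int1// mule1 ltry.
- exact/measurable_EFinP/averaging_measurable1.
- by move=> y _; rewrite lee_fin averaging_ge0.
Qed.

Lemma average_integrable f x : sqint mu f ->
  mu.-integrable setT (fun y => (K x y * f y)%:E).
Proof. by move=> sf; apply: sqint_integrableM => //; exact: averaging_sqint. Qed.

Lemma averageD f g x : sqint mu f -> sqint mu g ->
  average K (fun y => f y + g y) x = average K f x + average K g x.
Proof.
move=> sf sg; rewrite /average -RintegralD//; try exact: average_integrable.
by apply: eq_Rintegral => y _; rewrite mulrDr.
Qed.

Lemma averageZ c f x : sqint mu f ->
  average K (fun y => c * f y) x = c * average K f x.
Proof.
move=> sf; rewrite /average -RintegralZl//; try exact: average_integrable.
by apply: eq_Rintegral => y _; rewrite mulrCA.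
Qed.

Lemma averageB f g x : sqint mu f -> sqint mu g ->
  average K (fun y => f y - g y) x = average K f x - average K g x.
Proof.
move=> sf sg; rewrite /average -RintegralB//; try exact: average_integrable.
by apply: eq_Rintegral => y _; rewrite mulrBr.
Qed.

(** Tonelli's theorem gives the measurability of partial integrals of nonnegative functions, whence
    the split into positive and negative parts. *)
Lemma measurable_average f : measurable_fun setT f ->
  measurable_fun setT (average K f).
Proof.
move=> mf.
pose F (z : T * T) := (K z.1 z.2 * f z.2)%:E.
have mF : measurable_fun setT F.
  apply/measurable_EFinP; apply: measurable_funM.
    exact: averaging_measurable.
  exact: measurableT_comp.
rewrite /average /Rintegral; apply: measurableT_comp => //.
rewrite [X in measurable_fun _ X](_ : _ = fun x =>
  (\int[mu]_y (F^\+ (x, y)) - \int[mu]_y (F^\- (x, y)))%E); last first.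
  apply/funext => x; rewrite (integralE _ _ (fun y => F (x, y))).
  by congr (_ - _)%E; apply: eq_integral => y _; rewrite ?funeposE ?funenegE.
apply: emeasurable_funB.
  by apply: (measurable_fun_fubini_tonelli_F (F^\+)%E) => //; exact: measurable_funepos.
by apply: (measurable_fun_fubini_tonelli_F (F^\-)%E) => //; exact: measurable_funeneg.
Qed.

(* Jensen's inequality: expand the integral of [K x y * (f y - m)^2], where
   [m] is the mean of [f] for the density [K x]. *)
Lemma average_sqr f x : sqint mu f ->
  ((average K f x ^+ 2)%:E <= \int[mu]_y (K x y * f y ^+ 2)%:E)%E.
Proof.
move=> sf; set m := average K f x.
have iKf := average_integrable x sf.
have iK : mu.-integrable setT (fun y => (K x y)%:E).
  apply/integrableP; split.
    exact/measurable_EFinP/averaging_measurable1.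
  under eq_integral do rewrite gee0_abs ?lee_fin ?averaging_ge0//.
  by rewrite averaging_int1// ltry.
have [M KM] := averaging_bounded aK.
have iKf2 : mu.-integrable setT (fun y => (K x y * f y ^+ 2)%:E).
  apply: (@integrableMr _ _ _ mu setT measurableT (K x) (fun y => (f y ^+ 2)%:E)).
  - exact: averaging_measurable1.
  - exists M; split; first exact: num_real.
    move=> y My z _ /=; rewrite ger0_norm ?averaging_ge0//.
    exact: le_trans (KM _ _) (ltW My).
  - exact: sqint_integrable.
have : 0 <= \int[mu]_y (K x y * (f y - m) ^+ 2).
  by apply: Rintegral_ge0 => y _; rewrite mulr_ge0 ?averaging_ge0 ?sqr_ge0.
have -> : \int[mu]_y (K x y * (f y - m) ^+ 2) =
    \int[mu]_y (K x y * f y ^+ 2 + (- (2 * m) * (K x y * f y) + m ^+ 2 * K x y)).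
  by apply: eq_Rintegral => y _; ring.
have iZ c g : mu.-integrable setT (EFin \o g) ->
    mu.-integrable setT (EFin \o (fun y => c * g y)).
  by move=> ig; apply: (integrableZl measurableT c ig).
rewrite RintegralD//; last first.
  exact: (integrableD measurableT (iZ _ _ iKf) (iZ _ _ iK)).
rewrite RintegralD//; [|exact: iZ..].
rewrite !RintegralZl//.
rewrite -/m -/(average K f x) -/m.
rewrite [\int[mu]_y K x y](_ : _ = 1); last by rewrite /Rintegral averaging_int1.
move=> h; rewrite -[leRHS]fineK; last exact: integrable_fin_num.
rewrite lee_fin -/(Rintegral mu setT (fun y => K x y * f y ^+ 2)).
lra.
Qed.

(** After Jensen's inequality [average_sqr], Tonelli's theorem moves the integral in [x] inside,
    where the kernel has mass 1. *)
Lemma energy_average f : sqint mu f -> (energy mu (average K f) <= energy mu f)%E.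
Proof.
move=> sf; have [mf _] := sf.
pose F (z : T * T) := (K z.1 z.2 * f z.2 ^+ 2)%:E.
have mF : measurable_fun setT F.
  apply/measurable_EFinP; apply: measurable_funM.
    exact: averaging_measurable.
  by apply: measurable_funX; exact: measurableT_comp.
have F0 z : (0 <= F z)%E by rewrite lee_fin mulr_ge0 ?averaging_ge0 ?sqr_ge0.
apply: (@le_trans _ _ (\int[mu]_x \int[mu]_y F (x, y))%E).
  apply: ge0_le_integral => //.
  - by move=> x _; rewrite lee_fin sqr_ge0.
  - exact/measurable_sqr/measurable_average.
  - exact: (measurable_fun_fubini_tonelli_F F).
  - by move=> x _; exact: average_sqr.
rewrite fubini_tonelli//; apply: ge0_le_integral => //.
- by move=> x _; exact: integral_ge0.
- exact: (measurable_fun_fubini_tonelli_G F).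
- exact: measurable_sqr.
- move=> y _; rewrite /F /=.
  under eq_integral do rewrite mulrC EFinM.
  rewrite ge0_integralZl//.
  + by rewrite averaging_int2// mule1.
  + apply/measurable_EFinP; have := averaging_measurable aK.
    by move=> /(measurableT_comp)/(_ (pair2_measurable y)).
  + by move=> x _; rewrite lee_fin averaging_ge0.
  + by rewrite lee_fin sqr_ge0.
Qed.

Lemma sqint_average f : sqint mu f -> sqint mu (average K f).
Proof.
move=> sf; split; first by apply: measurable_average; case: sf.
by apply: le_lt_trans (energy_average sf) _; case: sf.
Qed.

(* [energy (Kf - f) = energy (Kf) - 2 int (Kf * f) + energy f] *)
Lemma energy_averageB f : sqint mu f ->
  (energy mu (fun x => average K f x - f x)%R <=
   (2 * (\int[mu]_x (f x ^+ 2) - \int[mu]_x (average K f x * f x)))%:E)%E.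
Proof.
move=> sf; have sKf := sqint_average sf.
rewrite -[leLHS]fineK; last first.
  by rewrite ge0_fin_numE ?energy_ge0//; case: (sqintB sKf sf).
rewrite lee_fin -/(Rintegral mu setT (fun x => (average K f x - f x) ^+ 2)).
have -> : \int[mu]_x (average K f x - f x) ^+ 2 =
    \int[mu]_x ((average K f x ^+ 2 + f x ^+ 2) - 2 * (average K f x * f x)).
  by apply: eq_Rintegral => x _; ring.
have i1 := sqint_integrable sKf; have i2 := sqint_integrable sf.
have i3 := sqint_integrableM sKf sf.
rewrite RintegralB//; last 2 first.
  exact: (integrableD measurableT i1 i2).
  exact: (integrableZl measurableT 2 i3).
rewrite RintegralD// RintegralZl//.
have : \int[mu]_x (average K f x ^+ 2) <= \int[mu]_x (f x ^+ 2).
  rewrite -lee_fin !fineK; [exact: energy_average|exact: integrable_fin_num..].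
lra.
Qed.

End averaging.

(** * From pointwise convergence on sets to convergence in L^2 *)

Section approximate_identity.
Context d (T : measurableType d) (R : realType).
Variable mu : {sigma_finite_measure set T -> \bar R}.
Implicit Types (f g : T -> R).
Variable K : nat -> T -> T -> R.
Hypothesis aK : forall n, averaging mu (K n).

Definition average_cvg f := sqint mu f /\ forall e : R, 0 < e ->
  \forall n \near \oo, (energy mu (fun x => average mu (K n) f x - f x)%R <= e%:E)%E.

Lemma average_cvgZ c f : average_cvg f -> average_cvg (fun x => c * f x).
Proof.
move=> [sf cf]; split; first exact: sqintZ.
move=> e e0; have c0 : 0 < c ^+ 2 + 1 by rewrite ltr_wpDl// sqr_ge0.
have := cf (e / (c ^+ 2 + 1)) (divr_gt0 e0 c0).
apply: filterS => n ne.
rewrite (_ : (fun x => _) = (fun x => c * (average mu (K n) f x - f x))); last first.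
  by apply/funext => x; rewrite (averageZ (aK n))// mulrBr.
rewrite energyZ; last first.
  by apply: measurable_funB; [apply: (measurable_average (aK n))|]; case: sf.
apply: le_trans (lee_wpmul2l _ ne) _; first by rewrite lee_fin sqr_ge0.
rewrite -EFinM lee_fin mulrCA ger_pMr// ler_pdivrMr// mul1r.
by rewrite lerDl.
Qed.

Lemma average_cvgD f g : average_cvg f -> average_cvg g ->
  average_cvg (fun x => f x + g x).
Proof.
move=> [sf cf] [sg cg]; split; first exact: sqintD.
move=> e e0; have e4 : 0 < e / 4 by rewrite divr_gt0.
have := cg _ e4; have := cf _ e4; apply: filterS2 => n nf ng.
rewrite (_ : (fun x => _) = (fun x => (average mu (K n) f x - f x) +
    (average mu (K n) g x - g x))); last first.
  by apply/funext => x; rewrite (averageD (aK n))//; ring.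
apply: le_trans (energyD _ _ _) _.
- by apply: measurable_funB; [apply: (measurable_average (aK n))|]; case: sf.
- by apply: measurable_funB; [apply: (measurable_average (aK n))|]; case: sg.
apply: (@le_trans _ _ (2%:E * ((e / 4)%:E + (e / 4)%:E))%E).
  by apply: lee_wpmul2l => //; exact: leeD.
by rewrite -EFinD -EFinM lee_fin; lra.
Qed.

Lemma average_cvgB f g : average_cvg f -> average_cvg g ->
  average_cvg (fun x => f x - g x).
Proof.
move=> cf /(average_cvgZ (-1)) /(average_cvgD cf).
by congr average_cvg; apply/funext => x; rewrite mulN1r.
Qed.

Lemma average_cvg0 : average_cvg (fun=> 0).
Proof.
have s0 : sqint mu (fun=> 0 : R).
  split=> //; rewrite /energy; under eq_integral do rewrite expr0n/=.
  by rewrite integral0.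
split => // e e0; near=> n.
rewrite [leLHS](_ : _ = 0%E) ?lee_fin ?(ltW e0)//.
rewrite -[RHS](integral0 mu setT); apply: eq_integral => x _.
rewrite /average /Rintegral; under eq_integral do rewrite mulr0.
by rewrite integral0 subrr expr0n.
Unshelve. all: by end_near. Qed.

Lemma average_cvg_sum (I : Type) (s : seq I) (F : I -> T -> R) :
  (forall i, average_cvg (F i)) -> average_cvg (fun x => \sum_(i <- s) F i x).
Proof.
move=> cF; elim: s => [|i s IH].
  by under eq_fun do rewrite big_nil; exact: average_cvg0.
by under eq_fun do rewrite big_cons; exact: average_cvgD.
Qed.

(** Write [K f - f] as [(K (f - g) - (f - g)) + (K g - g)]: averaging does not increase the energy
    of [f - g], whatever [n] is. *)
Lemma average_cvg_closed f : sqint mu f ->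
  (forall e : R, 0 < e -> exists2 g, average_cvg g &
    (energy mu (fun x => f x - g x)%R <= e%:E)%E) ->
  average_cvg f.
Proof.
(* The constant satisfies [2 * (2 * (e / 10 + e / 10) + e / 10) = e], with one factor 2 for
   [energyD] and one for [energyB]. *)
move=> sf fg; split => // e e0; have e10 : 0 < e / 10 by rewrite divr_gt0.
have [g [sg cg] gf] := fg _ e10.
have := cg _ e10; apply: filterS => n ng.
have sfg := sqintB sf sg.
rewrite (_ : (fun x => _) = (fun x => (average mu (K n) (fun y => f y - g y) x
   - (f x - g x)) + (average mu (K n) g x - g x))); last first.
  by apply/funext => x; rewrite (averageB (aK n))//; ring.
have mg : measurable_fun setT g by case: sg.
have mfg : measurable_fun setT (fun y => f y - g y) by case: sfg.
have mA h : measurable_fun setT h -> measurable_fun setT (average mu (K n) h).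
  exact: (measurable_average (aK n)).
apply: le_trans (energyD _ _ _) _.
- by apply: measurable_funB => //; exact: mA.
- by apply: measurable_funB => //; exact: mA.
apply: (@le_trans _ _ (2%:E * ((2 * (e / 10 + e / 10))%:E + (e / 10)%:E))%E).
  apply: lee_wpmul2l => //; apply: leeD => //.
  apply: le_trans (energyB _ _ _) _ => //; first exact: mA.
  rewrite EFinM; apply: lee_wpmul2l => //; rewrite EFinD; apply: leeD => //.
  by apply: le_trans gf; exact: (energy_average (aK n)).
rewrite [leLHS](_ : _ = (2 * (2 * (e / 10 + e / 10) + e / 10))%:E).
  by rewrite lee_fin; lra.
by rewrite [RHS]EFinM [in RHS]EFinD.
Qed.

(** By [energy_averageB], only the integral of [K 1_A * 1_A] needs a limit. Its integrand is
    dominated by [1_A], although the averages themselves spread outside of [A], so dominated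
    convergence applies. *)
Lemma average_cvg_indic (A : set T) : measurable A -> (mu A < +oo)%E ->
  (forall x, average mu (K n) \1_A x @[n --> \oo] --> (\1_A x : R)) ->
  average_cvg \1_A.
Proof.
move=> mA Aoo cA; have sA := sqint_indic mA Aoo.
split => // e e0.
have AA x : (\1_A x * \1_A x = \1_A x :> R).
  by rewrite indicE; case: (_ \in _); rewrite ?mul0r ?mul1r.
have iA : mu.-integrable setT (EFin \o (\1_A : T -> R)).
  have := sqint_integrableM sA sA; congr (integrable _ _).
  by apply/funext => x; rewrite AA.
have A01 n x : 0 <= average mu (K n) \1_A x <= 1.
  rewrite /average; apply/andP; split.
    by apply: Rintegral_ge0 => y _; rewrite mulr_ge0 ?(averaging_ge0 (aK n)).
  rewrite -lee_fin fineK; last first.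
    exact: (integrable_fin_num measurableT (average_integrable (aK n) x sA)).
  rewrite -(averaging_int1 (aK n) x); apply: ge0_le_integral => //.
  - by move=> y _; rewrite lee_fin mulr_ge0 ?(averaging_ge0 (aK n)).
  - by apply: (measurable_int mu); exact: (average_integrable (aK n)).
  - exact/measurable_EFinP/(averaging_measurable1 (aK n)).
  - by move=> y _; rewrite lee_fin ler_piMr ?(averaging_ge0 (aK n)).
pose F n x := ((average mu (K n) \1_A x * \1_A x)%:E).
have mK n : measurable_fun setT (average mu (K n) \1_A).
  by apply: (measurable_average (aK n)); exact: measurable_indic.
have iF n : mu.-integrable setT (F n).
  by apply: sqint_integrableM => //; exact: (sqint_average (aK n) sA).
have FA : {ae mu, forall x, setT x -> F ^~ x @ \oo --> (EFin \o \1_A) x}.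
  apply: aeW => x _; rewrite /F/=.
  apply: cvg_EFin; first exact: nearW.
  by rewrite -[X in _ --> X]AA; apply: cvgMl.
have F1 : {ae mu, forall x n, setT x -> (`|F n x| <= (EFin \o \1_A) x)%E}.
  apply: aeW => x n _; rewrite /F/= lee_fin.
  have /andP[a0 a1] := A01 n x.
  by rewrite ger0_norm ?mulr_ge0// ler_piMl.
have [_ _] := @dominated_convergence _ _ _ mu setT measurableT F
  (EFin \o \1_A) (EFin \o \1_A) (fun n => measurable_int mu (iF n))
  (measurable_int mu iA) FA iA F1.
have mAA : \int[mu]_x (\1_A x ^+ 2) = fine (mu A).
  rewrite /Rintegral; under eq_integral do rewrite expr2 AA.
  by rewrite integral_indic// setIT.
have fA : mu A \is a fin_num by rewrite ge0_fin_numE.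
have -> : (\int[mu]_x (EFin \o \1_A) x)%E = (fine (mu A))%:E.
  by rewrite fineK// integral_indic// setIT.
move=> cF.
have /cvgrPdist_le/(_ (e / 2)) : fine (\int[mu]_x F n x) @[n --> \oo] --> fine (mu A).
  by apply: fine_cvg.
rewrite divr_gt0// => /(_ isT); apply: filterS => n nF.
apply: le_trans (energy_averageB (aK n) sA) _.
rewrite lee_fin mAA.
have := ler_norm (fine (mu A) - fine (\int[mu]_x F n x)%E).
rewrite -/(Rintegral mu setT (fun x => average mu (K n) \1_A x * \1_A x)) in nF *.
lra.
Qed.

(** The last condition makes [f ^ 2] dominate [(f - g n) ^ 2], so that [g n] tends to [f] in L^2,
    and [average_cvg_closed] concludes. *)
Lemma average_cvg_dominated f (g : nat -> T -> R) : sqint mu f ->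
  (forall n, average_cvg (g n)) ->
  (forall x, g n x @[n --> \oo] --> f x) ->
  (forall n x, `|f x - g n x| <= `|f x|) ->
  average_cvg f.
Proof.
move=> sf cg gf fg; apply: average_cvg_closed => // e e0.
have mf : measurable_fun setT f by case: sf.
have mg n : measurable_fun setT (g n) by case: (cg n) => -[].
pose F n x := ((f x - g n x) ^+ 2)%:E.
have /= [] := @dominated_convergence _ _ _ mu setT measurableT F
  (fun=> 0%E) (fun x => (f x ^+ 2)%:E).
- by move=> n; apply/measurable_sqr/measurable_funB.
- by [].
- apply: aeW => x _; rewrite -[X in _ --> X]/(0%R%:E).
  apply: cvg_EFin; first exact: nearW.
  have h : f x - g n x @[n --> \oo] --> 0.
    by rewrite -[X in _ --> X](subrr (f x)); apply: cvgB => //; exact: cvg_cst.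
  by rewrite -[X in _ --> X](mulr0 0); apply: cvgM.
- exact: sqint_integrable.
- apply: aeW => x n _ /=; rewrite lee_fin ger0_norm ?sqr_ge0//.
  rewrite -(real_normK (num_real (f x - g n x))) -(real_normK (num_real (f x))).
  by rewrite lerXn2r ?nnegrE.
move=> _ _; rewrite integral0 => F0.
have : \forall n \near \oo, (\int[mu]_x F n x < e%:E)%E.
  by apply: cvge0_lt.
by case=> N _ /(_ N (leqnn N)) FN; exists (g N) => //; exact: ltW.
Qed.

(** Everything is intersected with a fixed [B] of finite measure, so that the indicators stay square
    integrable, even those of complements. *)
Lemma average_cvg_sigma (G : set (set T)) (B : set T) :
  @measurable _ T = <<s G >> -> setI_closed G ->
  (forall A, G A -> average_cvg \1_A) -> G B ->
  forall S, measurable S -> average_cvg \1_(S `&` B).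
Proof.
move=> GE GI cG GB S mS.
have mB : measurable B by rewrite GE; exact: sub_sigma_algebra.
have Boo : (mu B < +oo)%E.
  by have [[_ +] _] := cG _ GB; rewrite energy_indic.
apply: (@dynkin_induction _ T G (fun S => average_cvg \1_(S `&` B))) => //.
- by rewrite setTI; exact: cG.
- by move=> A GA; apply: cG; exact: GI.
(* The complement relative to [B] has indicator [1_B - 1_(A & B)], where [&] is the intersection. *)
- move=> A mA cA.
  have := average_cvgB (cG _ GB) cA; congr average_cvg.
  apply/funext => x; rewrite !indicE !in_setI in_setC.
  by case: (x \in A); case: (x \in B); rewrite ?subrr ?subr0.
- move=> F mF tF cF.
  (* The union of the first [n] sets: by disjointness its indicator is a finite sum, and it
     increases to that of the whole union. *)
  pose U n := [set x | exists2 k, (k < n)%N & F k x].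
  have mU : measurable (\bigcup_k F k) by exact: bigcupT_measurable.
  have UF n x : U n x -> (\bigcup_k F k) x by case=> k _ Fk; exists k.
  apply: (@average_cvg_dominated _ (fun n => \1_(U n `&` B))).
  + apply: sqint_indic; first exact: measurableI.
    by apply: le_lt_trans Boo; apply: le_measure; rewrite ?inE//; exact: measurableI.
  + elim=> [|n IH].
      rewrite (_ : U 0%N = set0) ?set0I ?indic0; first exact: average_cvg0.
      by apply/seteqP; split => // x [].
    have := average_cvgD IH (cF n); congr average_cvg.
    apply/funext => x; rewrite !indicE !in_setI.
    case: (x \in B); last by rewrite !andbF addr0.
    rewrite !andbT; have [Ux|Ux] := pselect (U n x).
      rewrite (mem_set Ux) memNset ?addr0 ?mem_set//.
        by have [k kn Fk] := Ux; exists k => //; exact: ltnW.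
      move=> Fn; have [k kn Fk] := Ux.
      have nk : n = k by apply: tF => //; exists x.
      by rewrite nk ltnn in kn.
    rewrite (memNset Ux) add0r; have [Fx|Fx] := pselect (F n x).
      by rewrite !mem_set//; exists n.
    rewrite !memNset// => -[k]; rewrite ltnS leq_eqVlt => /predU1P[->//|kn Fk].
    by apply: Ux; exists k.
  + move=> x; rewrite !indicE; apply: cvg_near_cst.
    have [Bx|Bx] := pselect (B x); last first.
      by apply: nearW => n; rewrite indicE !in_setI (memNset Bx) !andbF.
    have [[k _ Fk]|nx] := pselect ((\bigcup_k F k) x).
      exists k.+1 => // n /= kn; rewrite !indicE !in_setI (mem_set Bx) !mem_set//; by exists k.
    apply: nearW => n; rewrite !indicE !in_setI (memNset nx) memNset//.
    by move=> /UF.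
  + move=> n x; rewrite !indicE !in_setI.
    case: (x \in B); last by rewrite !andbF subrr normr0.
    rewrite !andbT; have [Ux|Ux] := pselect (U n x).
      by rewrite !mem_set ?subrr ?normr0//; exact: UF Ux.
    by rewrite (memNset Ux) subr0.
- by rewrite -GE.
Qed.

Import HBNNSimple.

(** Nonnegative functions are limits from below of simple functions, to which
    [average_cvg_dominated] applies. *)
Lemma average_cvg_sqint (B : set T) f :
  (forall S, measurable S -> average_cvg \1_(S `&` B)) ->
  sqint mu f -> (forall x, ~ B x -> f x = 0) -> average_cvg f.
Proof.
move=> cB.
wlog f0 : f / forall x, 0 <= f x.
  move=> H sf fB.
  have sa : sqint mu (fun x => `|f x|).
    have [mf fo] := sf; have ma := measurableT_comp (@normr_measurable R setT) mf.
    split => //; apply: le_lt_trans fo; apply: le_energy => // x.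
    by rewrite normr_id.
  have c1 : average_cvg (fun x => `|f x| + f x).
    apply: H; [|exact: sqintD|].
    - by move=> x; rewrite -lerBlDr sub0r -normrN ler_norm.
    - by move=> x /fB ->; rewrite normr0 addr0.
  have c2 : average_cvg (fun x => `|f x| - f x).
    apply: H; [|exact: sqintB|].
    - by move=> x; rewrite subr_ge0 ler_norm.
    - by move=> x /fB ->; rewrite normr0 subr0.
  (* [f] is half the difference of the nonnegative functions [|f| + f] and [|f| - f], which also
     vanish outside of [B]. *)
  have := average_cvgZ 2^-1 (average_cvgB c1 c2); congr average_cvg.
  by apply/funext => x; field.
move=> sf fB.
have mf : measurable_fun setT (EFin \o f) by apply/measurable_EFinP; case: sf.
pose s := nnsfun_approx measurableT mf.
have sle n x : s n x <= f x.
  by rewrite -lee_fin; rewrite /s nnsfun_approxE; apply: le_approx => //= y _; rewrite lee_fin.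
apply: (@average_cvg_dominated _ s) => //.
- move=> n.
  (* Since [0 <= s n <= f], the simple function [s n] vanishes outside of [B], and its level sets
     can be cut down to [B]. *)
  have [l sl] : exists l : seq R, s n =
      (fun x => \sum_(y <- l) y * \1_((s n @^-1` [set y]) `&` B) x) :> (T -> R).
    eexists; apply/funext => x.
    transitivity (s n x * \1_B x).
      rewrite indicE; have [Bx|Bx] := pselect (B x).
        by rewrite mem_set// mulr1.
      rewrite memNset// mulr0; apply/eqP; rewrite eq_le -{1}(fB _ Bx) sle/=.
      exact: fun_ge0.
    rewrite {1}(fimfunE (s n)) fsbig_finite//= mulr_suml; apply: eq_bigr => y _.
    by rewrite -mulrA !indicE in_setI; case: (_ \in _); rewrite ?mul1r ?mul0r.
  by rewrite sl; apply: average_cvg_sum => y; apply: average_cvgZ; exact: cB.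
- move=> x; have := cvg_nnsfun_approx measurableT mf (fun y _ => f0 y : (0 <= (f y)%:E)%E) (I : setT x).
  by move/fine_cvg.
- move=> n x; rewrite !ger0_norm//; first by rewrite lerBlDr lerDl fun_ge0.
  by rewrite subr_ge0.
Qed.

End approximate_identity.

(** * Smoothness of convolutions *)

Section plane.
Variable R : realType.
Implicit Types (p q : R * R) (f : R * R -> R).

Lemma shift_dx (h : R) p : h *: ((1, 0) : R * R) + p = (h + p.1, p.2).
Proof.
case: p => x y; apply: injective_projections => /=; rewrite ?scaler0 ?add0r//.
by rewrite [_ *: _]mulr1.
Qed.

Lemma shift_dy (h : R) p : h *: ((0, 1) : R * R) + p = (p.1, h + p.2).
Proof.
case: p => x y; apply: injective_projections => /=; rewrite ?scaler0 ?add0r//.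
by rewrite [_ *: _]mulr1.
Qed.

Lemma lipschitz_continuous2 f (C : R) :
  (forall p q, `|f p - f q| <= C * (`|p.1 - q.1| + `|p.2 - q.2|)) -> continuous f.
Proof.
move=> fC p; apply/cvgrPdist_le => e e0.
pose C' := `|C| + 1.
have C0 : 0 < C' by rewrite ltr_wpDl.
near=> q.
have h1 : `|p.1 - q.1| <= e / (2 * C').
  near: q; apply: (@cvgr_dist_le _ _ _ _ _ fst p.1); last by rewrite divr_gt0// mulr_gt0.
  exact: cvg_fst.
have h2 : `|p.2 - q.2| <= e / (2 * C').
  near: q; apply: (@cvgr_dist_le _ _ _ _ _ snd p.2); last by rewrite divr_gt0// mulr_gt0.
  exact: cvg_snd.
apply: le_trans (fC p q) _.
apply: (@le_trans _ _ (C' * (`|p.1 - q.1| + `|p.2 - q.2|))).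
  by rewrite ler_wpM2r ?addr_ge0// (le_trans (ler_norm C))// lerDl.
apply: (@le_trans _ _ (C' * (e / (2 * C') + e / (2 * C')))).
  by rewrite ler_wpM2l ?(ltW C0)// lerD.
by rewrite le_eqVlt; apply/orP; left; apply/eqP; field; rewrite gt_eqF.
Unshelve. all: by end_near. Qed.

Section family.
Variable F : nat * nat -> R * R -> R.
Hypothesis cF : forall i, continuous (F i).
Hypothesis dF1 : forall i p, is_derive p ((1, 0) : R * R) (F i) (F (i.1.+1, i.2) p).
Hypothesis dF2 : forall i p, is_derive p ((0, 1) : R * R) (F i) (F (i.1, i.2.+1) p).

Lemma dx_family i : dx (F i) = F (i.1.+1, i.2).
Proof. by apply/funext => p; rewrite /dx derive_val. Qed.

Lemma dy_family i : dy (F i) = F (i.1, i.2.+1).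
Proof. by apply/funext => p; rewrite /dy derive_val. Qed.

(** The induction on [k] ranges over all members at once, since the derivatives of a member are
    other members. Both [tensor] and [convolution] are such families. *)
Lemma smooth_family i : smooth (F i).
Proof.
move=> k; elim: k i => [|k IH] i; split=> //; split.
- by move=> p; case: (dF1 i p).
- by move=> p; case: (dF2 i p).
- by rewrite dx_family.
- by rewrite dy_family.
Qed.

End family.

Section tensor.
Variables a b : nat -> R -> R.
Hypothesis ja : jet a.
Hypothesis jb : jet b.

(** For jets, the derivative of order [i] of the product of [a 0] and [b 0]. The jets differ when a
    kernel is reflected about a point, whose two coordinates differ. *)
Definition tensor (i : nat * nat) p := a i.1 p.1 * b i.2 p.2.

Lemma tensor_bounded i : exists M, forall p, `|tensor i p| <= M.
Proof.
have [M aM] := jet_bounded ja i.1; have [N bN] := jet_bounded jb i.2.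
by exists (M * N) => p; rewrite normrM ler_pM.
Qed.

Lemma tensor_lipschitz i : exists C, forall p q,
  `|tensor i p - tensor i q| <= C * (`|p.1 - q.1| + `|p.2 - q.2|).
Proof.
have [M aM] := jet_bounded ja i.1; have [N bN] := jet_bounded jb i.2.
have [M' aM'] := jet_bounded ja i.1.+1; have [N' bN'] := jet_bounded jb i.2.+1.
have M0 : 0 <= M by apply: le_trans (aM 0).
have N0 : 0 <= N by apply: le_trans (bN 0).
have M0' : 0 <= M' by apply: le_trans (aM' 0).
have N0' : 0 <= N' by apply: le_trans (bN' 0).
exists (M' * N + M * N') => p q; rewrite /tensor.
have -> : a i.1 p.1 * b i.2 p.2 - a i.1 q.1 * b i.2 q.2 =
  (a i.1 p.1 - a i.1 q.1) * b i.2 p.2 + a i.1 q.1 * (b i.2 p.2 - b i.2 q.2) by ring.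
apply: le_trans (ler_normD _ _) _; rewrite !normrM.
have h1 := derive_lipschitz q.1 p.1 (jet_derive ja i.1) aM'.
have h2 := derive_lipschitz q.2 p.2 (jet_derive jb i.2) bN'.
apply: (@le_trans _ _ ((M' * `|p.1 - q.1|) * N + M * (N' * `|p.2 - q.2|))).
  by apply: lerD; apply: ler_pM.
have {h1 h2 aM bN aM' bN'} h (A B A' B' u v : R) : 0 <= A -> 0 <= B -> 0 <= A' ->
    0 <= B' -> 0 <= u -> 0 <= v ->
    A' * u * B + A * (B' * v) <= (A' * B + A * B') * (u + v).
  move=> A0 B0 A0' B0' u0 v0.
  have := mulr_ge0 (mulr_ge0 A0 B0') u0; have := mulr_ge0 (mulr_ge0 A0' B0) v0; lra.
exact: h.
Qed.

(** The constant does not depend on [p], because the bound is later integrated over all translates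
    of the kernel. *)
Lemma tensor_taylor1 i : exists C, forall p h,
  `|tensor i (h + p.1, p.2) - tensor i p - h * tensor (i.1.+1, i.2) p| <= C * h ^+ 2.
Proof.
have [M aM] := jet_bounded ja i.1.+2; have [N bN] := jet_bounded jb i.2.
exists (M * N) => p h; rewrite /tensor/= (addrC h).
rewrite mulrA -!mulrBl normrM mulrAC; apply: ler_pM => //.
exact: (derive_taylor _ _ (jet_derive ja i.1) (jet_derive ja i.1.+1)).
Qed.

Lemma tensor_taylor2 i : exists C, forall p h,
  `|tensor i (p.1, h + p.2) - tensor i p - h * tensor (i.1, i.2.+1) p| <= C * h ^+ 2.
Proof.
have [M aM] := jet_bounded ja i.1; have [N bN] := jet_bounded jb i.2.+2.
exists (M * N) => p h; rewrite /tensor/= (addrC h).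
rewrite mulrCA -!mulrBr normrM -mulrA; apply: ler_pM => //.
exact: (derive_taylor _ _ (jet_derive jb i.2) (jet_derive jb i.2.+1)).
Qed.

Lemma tensor_continuous i : continuous (tensor i).
Proof. by have [C /lipschitz_continuous2] := tensor_lipschitz i. Qed.

Lemma tensor_dx i p : is_derive p ((1, 0) : R * R) (tensor i) (tensor (i.1.+1, i.2) p).
Proof.
have [C hC] := tensor_taylor1 i.
by apply: (@derive_quadratic _ _ _ _ _ _ C) => h; rewrite shift_dx.
Qed.

Lemma tensor_dy i p : is_derive p ((0, 1) : R * R) (tensor i) (tensor (i.1, i.2.+1) p).
Proof.
have [C hC] := tensor_taylor2 i.
by apply: (@derive_quadratic _ _ _ _ _ _ C) => h; rewrite shift_dy.
Qed.

Lemma measurable_tensor i : measurable_fun setT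
  (tensor i : measurableTypeR R * measurableTypeR R -> R).
Proof.
apply: measurable_funM.
  apply: (measurableT_comp (f := a i.1)) => //.
  by apply: continuous_measurable_fun; exact: jet_continuous.
apply: (measurableT_comp (f := b i.2)) => //.
by apply: continuous_measurable_fun; exact: jet_continuous.
Qed.

Local Notation T := (measurableTypeR R * measurableTypeR R)%type.
Variable mu : {measure set T -> \bar R}.
Variable g : T -> R.
Hypothesis ig : mu.-integrable setT (EFin \o g).

Definition convolution (i : nat * nat) p : R :=
  \int[mu]_q (tensor i (p.1 - q.1, p.2 - q.2) * g q).

Lemma measurable_tensorB i p :
  measurable_fun setT (fun q : T => tensor i (p.1 - q.1, p.2 - q.2)).
Proof.
apply: (measurableT_comp (measurable_tensor i)).
apply/measurable_fun_pairP; split; apply: measurable_funB => //.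
Qed.

Lemma convolution_integrable i p :
  mu.-integrable setT (EFin \o (fun q => tensor i (p.1 - q.1, p.2 - q.2) * g q)).
Proof.
have [M iM] := tensor_bounded i.
apply: (@integrableMr _ _ _ mu setT measurableT
  (fun q : T => tensor i (p.1 - q.1, p.2 - q.2)) (EFin \o g)) => //.
  exact: measurable_tensorB.
exists M; split; first exact: num_real.
by move=> y My z _ /=; apply: le_trans (iM _) (ltW My).
Qed.

Lemma le_convolution (C : R) (k : T -> R) :
  mu.-integrable setT (EFin \o (fun q => k q * g q)) -> (forall q, `|k q| <= C) ->
  `|\int[mu]_q (k q * g q)| <= C * \int[mu]_q `|g q|.
Proof.
move=> ik kC; have in_ := integrable_norm ig.
apply: le_trans (le_normr_Rintegral _ ik) _ => //.
rewrite -RintegralZl//; apply: le_Rintegral => //.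
- exact: integrable_norm.
- exact: (integrableZl measurableT C in_).
- by move=> q _; rewrite normrM ler_wpM2r.
Qed.

(** The uniform remainder of the kernel, integrated against [|g|], is the remainder of the
    convolution. Here [s] is a shift along either axis, which commutes with the translation by
    [q]. *)
Lemma convolution_taylor (i j : nat * nat) (s : R -> R * R -> R * R) (C : R) :
  (forall p q h, ((s h p).1 - q.1, (s h p).2 - q.2) = s h (p.1 - q.1, p.2 - q.2)) ->
  (forall p h, `|tensor i (s h p) - tensor i p - h * tensor j p| <= C * h ^+ 2) ->
  forall p h, `|convolution i (s h p) - convolution i p - h * convolution j p|
    <= C * (\int[mu]_q `|g q|) * h ^+ 2.
Proof.
move=> sE sC p h.
have i1 := convolution_integrable i (s h p).
have i2 := convolution_integrable i p.
have i3 := convolution_integrable j p.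
have i12 : mu.-integrable setT (EFin \o (fun q =>
    tensor i ((s h p).1 - q.1, (s h p).2 - q.2) * g q -
    tensor i (p.1 - q.1, p.2 - q.2) * g q)).
  exact: (integrableB measurableT i1 i2).
have i4 : mu.-integrable setT (EFin \o (fun q =>
    h * (tensor j (p.1 - q.1, p.2 - q.2) * g q))).
  exact: (integrableZl measurableT h i3).
rewrite /convolution -RintegralB// -RintegralZl// -RintegralB//.
pose k q := tensor i (s h (p.1 - q.1, p.2 - q.2)) - tensor i (p.1 - q.1, p.2 - q.2)
  - h * tensor j (p.1 - q.1, p.2 - q.2).
have E q : tensor i ((s h p).1 - q.1, (s h p).2 - q.2) * g q -
    tensor i (p.1 - q.1, p.2 - q.2) * g q -
    h * (tensor j (p.1 - q.1, p.2 - q.2) * g q) = k q * g q.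
  by rewrite sE /k; ring.
under eq_Rintegral do rewrite E.
rewrite (mulrAC C); apply: le_convolution => //.
have := integrableB measurableT i12 i4.
by congr (integrable _ _); apply/funext => q; rewrite /= -EFinB E.
by move=> q; exact: sC.
Qed.

Lemma convolution_continuous i : continuous (convolution i).
Proof.
have [C hC] := tensor_lipschitz i.
apply: (@lipschitz_continuous2 _ (C * \int[mu]_q `|g q|)) => p p'.
have i1 := convolution_integrable i p.
have i2 := convolution_integrable i p'.
rewrite /convolution -RintegralB//.
under eq_Rintegral do rewrite -mulrBl.
rewrite mulrAC; apply: le_convolution.
  have := integrableB measurableT i1 i2.
  by congr (integrable _ _); apply/funext => q; rewrite /= -EFinB mulrBl.
move=> q; apply: le_trans (hC _ _) _ => /=.
by rewrite !(opprB _ q.1) !(opprB _ q.2) !addrA !subrK.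
Qed.

Lemma convolution_dx i p :
  is_derive p ((1, 0) : R * R) (convolution i) (convolution (i.1.+1, i.2) p).
Proof.
have [C hC] := tensor_taylor1 i.
apply: (@derive_quadratic _ _ _ _ _ _ (C * \int[mu]_q `|g q|)) => h; rewrite shift_dx.
apply: (@convolution_taylor i (i.1.+1, i.2) (fun h p => (h + p.1, p.2))) => //.
by move=> *; rewrite /= addrA.
Qed.

Lemma convolution_dy i p :
  is_derive p ((0, 1) : R * R) (convolution i) (convolution (i.1, i.2.+1) p).
Proof.
have [C hC] := tensor_taylor2 i.
apply: (@derive_quadratic _ _ _ _ _ _ (C * \int[mu]_q `|g q|)) => h; rewrite shift_dy.
apply: (@convolution_taylor i (i.1, i.2.+1) (fun h p => (p.1, h + p.2))) => //.
by move=> *; rewrite /= addrA.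
Qed.

End tensor.
End plane.

(** * Approximate identities of the plane *)

Section plane_measure.
Variable R : realType.
Local Notation T := (measurableTypeR R * measurableTypeR R)%type.
Local Notation leb := (@lebesgue_measure R).

(* The library declares [\x] sigma-finite only for subprobabilities. *)
Definition plane_measure : set T -> \bar R := (leb \x leb)%E.
HB.instance Definition _ := Measure.on plane_measure.

Let plane_measure_sigma_finite : sigma_finite setT plane_measure.
Proof.
have /sigma_finiteP[F [TF ndF Foo]] := sigma_finiteT leb.
exists (fun n => F n `*` F n).
  rewrite -setXTT TF predeqE => -[x y]; split.
    move=> [/= [n _ Fnx] [k _ Gky]]; exists (maxn n k) => //; split.
    - by move: x Fnx; exact/subsetPset/ndF/leq_maxl.
    - by move: y Gky; exact/subsetPset/ndF/leq_maxr.
  by move=> [n _ []/= ? ?]; split; exists n.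
move=> k; have [mF Fk] := Foo k.
split; first exact: measurableX.
by rewrite /plane_measure product_measure1E// lte_mul_pinfty// ge0_fin_numE.
Qed.

HB.instance Definition _ := Measure_isSigmaFinite.Build _ _ _ plane_measure
  plane_measure_sigma_finite.

Local Notation leb2 := plane_measure.
Implicit Types (p q : R * R).

(** Measurability is for the product sigma-algebra; an open set belongs to it as the countable union
    of the rational rectangles that it contains. *)
Lemma open_plane_measurable (O : set (R * R)) : open O -> measurable (O : set T).
Proof.
move=> oO.
pose rect (i : (rat * rat) * (rat * rat)) : set (R * R) :=
  `]ratr i.1.1, ratr i.1.2[%classic `*` `]ratr i.2.1, ratr i.2.2[%classic.
have -> : O = \bigcup_(i in [set i | rect i `<=` O]) rect i.
  apply/seteqP; split => [p Op|p [i /= iO] /iO//].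
  have [e /= e0 eO] : nbhs_ball p O by apply/nbhs_ballP; exact: oO.
  have itv (x : R) : exists ab : rat * rat,
      [/\ ratr ab.1 < x, x < ratr ab.2, x - e < ratr ab.1 & ratr ab.2 < x + e].
    have [|a] := @rat_in_itvoo R (x - e) x; first by rewrite ltrBlDr ltrDl.
    rewrite in_itv/= => /andP[a1 a2].
    have [|b] := @rat_in_itvoo R x (x + e); first by rewrite ltrDl.
    by rewrite in_itv/= => /andP[b1 b2]; exists (a, b).
  have [i1 [i1a i1b i1c i1d]] := itv p.1.
  have [i2 [i2a i2b i2c i2d]] := itv p.2.
  exists (i1, i2); last by split; rewrite /= in_itv/= ?i1a ?i2a.
  move=> q [/=]; rewrite !in_itv/= => /andP[q1 q1'] /andP[q2 q2'].
  apply: eO; split; rewrite /ball/= ltr_norml; apply/andP; split; lra.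
rewrite bigcup_mkcond; apply: countable_bigcupT_measurable => [|i].
  exact: countableP.
by case: ifP => // _; apply: measurableX; exact: measurable_itv.
Qed.

Lemma continuous_plane_measurable (f : R * R -> R) : continuous f ->
  measurable_fun setT (f : T -> R).
Proof.
move=> cf; apply: (@measurability _ _ T (measurableTypeR R) setT f _ (RGenOInfty.measurableE R)) => _ [_ [a ->] <-].
by rewrite setTI; apply: open_plane_measurable; apply: open_comp.
Qed.

(** Open on the left and below, closed on the right and above: a point of such a set has room to its
    left and below, which is where its kernel looks. The sides are also the intervals that generate
    the measurable sets of the line. *)
Definition oc_rectangles : set (set T) :=
  [set A | exists a b c d : R, A = `]a, b]%classic `*` `]c, d]%classic].

Lemma oc_rectangles_setI : setI_closed oc_rectangles.
Proof.
move=> _ _ [a [b [c [d ->]]]] [a' [b' [c' [d' ->]]]].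
exists (Num.max a a'), (Num.min b b'), (Num.max c c'), (Num.min d d').
apply/seteqP; split => -[x y] /=; rewrite !in_itv/= !gt_max !le_min.
  by move=> [[/andP[-> ->] /andP[-> ->]] [/andP[-> ->] /andP[-> ->]]].
by move=> [/andP[/andP[-> ->] /andP[-> ->]] /andP[/andP[-> ->] /andP[-> ->]]].
Qed.

(** A product is the intersection of a vertical and a horizontal strip. The strips over an interval
    are countable unions of rectangles, and the bases of strips in the generated sigma-algebra form
    a sigma-algebra. *)
Lemma measurable_oc_rectangles : @measurable _ T = <<s oc_rectangles >>.
Proof.
rewrite measurable_prod_measurableType; apply/seteqP; split; last first.
  apply: smallest_sub; first exact: smallest_sigma_algebra.
  move=> _ [a [b [c [d ->]]]]; apply: sub_sigma_algebra.
  by exists `]a, b]%classic => //; exists `]c, d]%classic.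
apply: smallest_sub; first exact: smallest_sigma_algebra.
have [S0 SC SU] := smallest_sigma_algebra [set: T] oc_rectangles.
have setT_oc : [set: R] = \bigcup_(n : nat) `]- n%:R, n%:R]%classic.
  apply/seteqP; split => // x _; exists (Num.bound `|x|) => //=.
  have := archi_boundP (normr_ge0 x); rewrite ltr_norml => /andP[h1 h2].
  by rewrite in_itv/= h1 ltW.
have S1 (A : set (measurableTypeR R)) : measurable A -> <<s oc_rectangles >> (A `*` setT).
  suff : measurable `<=` [set A | <<s oc_rectangles >> (A `*` setT)] by apply.
  apply: smallest_sub => [|_ [[a b] _ <-]].
    split => /=.
    - by rewrite set0X.
    - move=> B /SC; congr (<<s _ >> _); rewrite !setTD.
      by apply/seteqP; split => -[x y] /=; tauto.
    - move=> F SF; rewrite setX_bigcupl; exact: SU.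
  rewrite /= setT_oc setX_bigcupr.
  apply: SU => n; apply: sub_sigma_algebra.
  by exists a, b, (- n%:R), n%:R.
have S2 (B : set (measurableTypeR R)) : measurable B -> <<s oc_rectangles >> (setT `*` B).
  suff : measurable `<=` [set B | <<s oc_rectangles >> (setT `*` B)] by apply.
  apply: smallest_sub => [|_ [[a b] _ <-]].
    split => /=.
    - by rewrite setX0.
    - move=> A /SC; congr (<<s _ >> _); rewrite !setTD.
      by apply/seteqP; split => -[x y] /=; tauto.
    - move=> F SF; rewrite setX_bigcupr; exact: SU.
  rewrite /= setT_oc setX_bigcupl.
  apply: SU => n; apply: sub_sigma_algebra.
  by exists (- n%:R), n%:R, a, b.
move=> _ [A mA [B mB <-]].
have := @measurableI _ (g_sigma_algebraType oc_rectangles) _ _ (S1 _ mA) (S2 _ mB).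
by rewrite -setXI setIT setTI.
Qed.

(* The kernel [k(x) k(y)] and all its derivatives vanish outside of
   [e, 2 e] x [e, 2 e], so that the averages at [p] only involve the points
   to the left of and below [p]. *)
Record mollifier (e : R) (a : nat -> R -> R) : Prop := Mollifier {
  mollifier_jet : jet a;
  mollifier_support : forall n x, a n x != 0 -> e <= x <= 2 * e;
  mollifier_ge0 : forall x, 0 <= a 0%N x;
  mollifier_int : (\int[leb]_y (a 0%N y)%:E = 1)%E }.

Definition product_kernel (a : nat -> R -> R) (p q : T) : R :=
  tensor a a (0%N, 0%N) (p.1 - q.1, p.2 - q.2).

Lemma plane_integral_prod (f g : R -> R) : measurable_fun setT f ->
  measurable_fun setT g -> (forall x, 0 <= f x) -> (forall x, 0 <= g x) ->
  (\int[leb2]_p (f p.1 * g p.2)%:E =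
   (\int[leb]_x (f x)%:E) * (\int[leb]_y (g y)%:E))%E.
Proof.
move=> mf mg f0 g0.
have mE h : measurable_fun setT h -> measurable_fun setT (EFin \o h : R -> \bar R).
  by move=> mh; exact/measurable_EFinP.
transitivity (\int[leb]_x \int[leb]_y (f x * g y)%:E)%E.
  apply: (@fubini_tonelli1 _ _ _ _ _ leb leb (fun p => (f p.1 * g p.2)%:E)).
    by apply/measurable_EFinP/measurable_funM; exact: measurableT_comp.
  by move=> p; rewrite lee_fin mulr_ge0.
transitivity (\int[leb]_x ((f x)%:E * \int[leb]_y (g y)%:E))%E.
  apply: eq_integral => x _; under eq_integral do rewrite EFinM.
  rewrite ge0_integralZl//; first exact: mE.
  - by move=> y _; rewrite lee_fin.
  - by rewrite lee_fin.
rewrite ge0_integralZr//; first exact: mE.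
- by move=> y _; rewrite lee_fin.
- by apply: integral_ge0 => y _; rewrite lee_fin.
Qed.

(** Mass 1 in the second variable is invariance of the Lebesgue measure under reflections; in the
    first one, under translations. *)
Lemma kernel_averaging e a : mollifier e a -> averaging leb2 (product_kernel a).
Proof.
move=> [ja sa a0 a1].
have cont : continuous (a 0%N) by exact: jet_continuous.
have ma : measurable_fun setT (fun x => (a 0%N x)%:E).
  by apply/measurable_EFinP; exact: continuous_measurable_fun.
have ma' : measurable_fun setT (a 0%N) by exact: continuous_measurable_fun.
have mT : measurable_fun setT (tensor a a (0%N, 0%N) : T -> R).
  exact: measurable_tensor.
split.
- by move=> p q; rewrite mulr_ge0.
- apply: (measurableT_comp mT).
  apply/measurable_fun_pairP; split; apply: measurable_funB => //=.
  + exact: measurableT_comp.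
  + exact: measurableT_comp.
  + exact: measurableT_comp.
  + exact: measurableT_comp.
- have [M aM] := tensor_bounded ja ja (0%N, 0%N).
  by exists M => p q; apply: le_trans (aM _); exact: ler_norm.
- move=> p.
  rewrite (plane_integral_prod (f := fun x => a 0%N (p.1 - x)) (g := fun x => a 0%N (p.2 - x)))//.
  + by rewrite !ge0_integral_reflect// a1 mule1.
  + by apply: (measurableT_comp ma'); exact: measurable_funB.
  + by apply: (measurableT_comp ma'); exact: measurable_funB.
- move=> q.
  rewrite (plane_integral_prod (f := fun x => a 0%N (x - q.1)) (g := fun x => a 0%N (x - q.2)))//.
  + by rewrite !ge0_integral_translate// a1 mule1.
  + by apply: (measurableT_comp ma'); exact: measurable_funB.
  + by apply: (measurableT_comp ma'); exact: measurable_funB.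
Qed.

Lemma kernel_support e a p q : mollifier e a -> product_kernel a p q != 0 ->
  [/\ p.1 - 2 * e <= q.1, q.1 <= p.1 - e, p.2 - 2 * e <= q.2 & q.2 <= p.2 - e].
Proof.
move=> [_ sa _ _]; rewrite mulf_eq0 negb_or => /andP[/sa/= /andP[? ?] /sa/= /andP[? ?]].
by split; lra.
Qed.

Lemma average_kernel_eq1 e a (A : set T) p : mollifier e a ->
  (forall q, product_kernel a p q != 0 -> A q) -> average leb2 (product_kernel a) \1_A p = 1.
Proof.
move=> ma pA; have aK := kernel_averaging ma.
rewrite /average /Rintegral -[RHS]/(fine 1%E) -(averaging_int1 aK p).
congr fine; apply: eq_integral => q _; congr EFin.
have [-> |/pA Aq] := eqVneq (product_kernel a p q) 0; first by rewrite mul0r.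
by rewrite indicE mem_set// mulr1.
Qed.

Lemma average_kernel_eq0 e a (f : T -> R) p : mollifier e a ->
  (forall q, product_kernel a p q != 0 -> f q = 0) -> average leb2 (product_kernel a) f p = 0.
Proof.
move=> ma pA; rewrite /average /Rintegral -[RHS]/(fine 0%E) -(integral0 leb2 setT).
congr fine; apply: eq_integral => q _; congr EFin.
by have [-> |/pA ->] := eqVneq (product_kernel a p q) 0; rewrite ?mul0r ?mulr0.
Qed.

Section approximation.
Variables (e : nat -> R) (a : nat -> nat -> R -> R).
Hypothesis e0 : forall n, 0 < e n.
Hypothesis cvg_e : e n @[n --> \oo] --> 0.
Hypothesis ma : forall n, mollifier (e n) (a n).

Let aK n := kernel_averaging (ma n).

Lemma average_cvg_rectangle A : oc_rectangles A ->
  average_cvg leb2 (fun n => product_kernel (a n)) \1_A.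
Proof.
move=> [x1 [x2 [y1 [y2 ->]]]].
have small (r : R) : 0 < r -> \forall n \near \oo, 2 * e n < r.
  move=> r0; have r2 : 0 < r / 2 by rewrite divr_gt0.
  near=> n; have : e n < r / 2 by near: n; exact: cvgr_lt cvg_e _ r2.
  lra.
apply: average_cvg_indic => //; first exact: measurableX.
  rewrite /= /plane_measure product_measure1E//= !lebesgue_measure_itv/=.
  by do 2 case: ifP => _; rewrite -?EFinB -?EFinM ?mule0 ?mul0e ltry.
(* At each point the averages are not only convergent but eventually equal to their limit, 1 or
   0. *)
move=> p; apply: cvg_near_cst.
have [[/=]|pA] := pselect ((`]x1, x2]%classic `*` `]y1, y2]%classic) p).
  rewrite !in_itv/= => /andP[p1 p2] /andP[p3 p4].
  rewrite indicE mem_set; last by split; rewrite /= in_itv/= ?p1 ?p3.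
  have h1 : 0 < p.1 - x1 by rewrite subr_gt0.
  have h2 : 0 < p.2 - y1 by rewrite subr_gt0.
  apply: filterS2 (small _ h1) (small _ h2) => n n1 n2.
  apply: (average_kernel_eq1 (ma n)) => q /(kernel_support (ma n))[q1 q2 q3 q4].
  by have := e0 n; split; rewrite /= in_itv/=; lra.
rewrite indicE memNset//.
have H n : (forall q, product_kernel (a n) p q != 0 ->
    ~ (`]x1, x2]%classic `*` `]y1, y2]%classic) q) ->
    average leb2 (product_kernel (a n)) \1_(`]x1, x2] `*` `]y1, y2]) p = 0.
  by move=> Hq; apply: (average_kernel_eq0 (ma n)) => q /Hq qA; rewrite indicE memNset.
(* To the left of the rectangle or below it, the average is 0 for every [n]; to the right or above,
   it is 0 once the support, of reach [2 * e n], no longer meets the rectangle. *)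
have [c1|c1] := leP p.1 x1.
  apply: nearW => n; apply: H => q /(kernel_support (ma n))[q1 q2 q3 q4] [/=].
  by rewrite !in_itv/= => /andP[r1 r2] _; have := e0 n; lra.
have [c2|c2] := ltP x2 p.1.
  have h : 0 < p.1 - x2 by rewrite subr_gt0.
  apply: filterS (small _ h) => n n1.
  apply: H => q /(kernel_support (ma n))[q1 q2 q3 q4] [/=].
  by rewrite !in_itv/= => /andP[r1 r2] _; lra.
have [c3|c3] := leP p.2 y1.
  apply: nearW => n; apply: H => q /(kernel_support (ma n))[q1 q2 q3 q4] [/=].
  by rewrite !in_itv/= => _ /andP[r1 r2]; have := e0 n; lra.
have [c4|c4] := ltP y2 p.2.
  have h : 0 < p.2 - y2 by rewrite subr_gt0.
  apply: filterS (small _ h) => n n1.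
  apply: H => q /(kernel_support (ma n))[q1 q2 q3 q4] [/=].
  by rewrite !in_itv/= => _ /andP[r1 r2]; lra.
by exfalso; apply: pA; split; rewrite /= in_itv/= ?c1 ?c2 ?c3 ?c4.
Unshelve. all: by end_near. Qed.

Lemma average_cvg_plane (l1 l2 : R) (f : T -> R) : sqint leb2 f ->
  (forall p, ~ Omega l1 l2 p -> f p = 0) ->
  average_cvg leb2 (fun n => product_kernel (a n)) f.
Proof.
(* Omega is open, hence the enlargement to the half-open rectangle with the same corners. *)
move=> sf fO; apply: (average_cvg_sqint aK (B := `]0, l1] `*` `]0, l2])) => //.
- apply: (average_cvg_sigma aK measurable_oc_rectangles oc_rectangles_setI).
    exact: average_cvg_rectangle.
  by exists 0, l1, 0, l2.
- move=> p pB; apply: fO => -[/=]; rewrite !in_itv/=.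
  move=> /andP[p1 p1'] /andP[p2 p2']; apply: pB.
  by split; rewrite /= in_itv/= ?p1 ?p2 ltW.
Qed.

End approximation.
End plane_measure.

(** * Energies and L^2 norms *)

Lemma poweR_sqr (R : realType) (x : \bar R) : (0 <= x)%E -> (x `^ 2 = x ^+ 2)%E.
Proof.
case: x => [r| |]//; first by rewrite lee_fin => r0; rewrite poweR_EFin powR_mulrn// EFin_expe.
by move=> _; rewrite /poweR pnatr_eq0 expe2 mulyy.
Qed.

Section L2_energy.
Context d (T : measurableType d) (R : realType).
Variable mu : {measure set T -> \bar R}.
Implicit Types (A : set T) (u v : T -> R).

Lemma L2norm_sqr A u : (L2norm mu A u ^+ 2 = energy mu (u \_ A))%E.
Proof.
rewrite /L2norm /energy.
have := @poweR_Lnorm _ T R mu (EFin \o u \_ A) 2.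
rewrite pnatr_eq0 => /(_ isT).
rewrite poweR_sqr; last exact: Lnorm_ge0.
move=> ->.
apply: eq_integral => x _.
transitivity ((`|(u \_ A) x| `^ 2)%:E)%R; first by [].
by rewrite powR_mulrn// real_normK// num_real.
Qed.

Lemma L2P A u : L2 mu A u <-> sqint mu (u \_ A).
Proof.
rewrite /L2; split.
  move=> h; split.
    by move: h; rewrite inE => /andP[]; rewrite inE.
  move: h; rewrite inE => /andP[_]; rewrite inE /finite_norm/= => h.
  rewrite -L2norm_sqr -poweR_sqr ?Lnorm_ge0//; exact: poweR_lty.
move=> [mu_ h]; rewrite inE; apply/andP; split; rewrite inE//.
rewrite /finite_norm/= -/(L2norm mu A u).
apply: (@lty_poweRy _ _ 2) => //.
by rewrite poweR_sqr ?Lnorm_ge0// L2norm_sqr.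
Qed.

Lemma restrictB A u v : (u \- v) \_ A = (fun x => (u \_ A) x - (v \_ A) x).
Proof.
by apply/funext => x; rewrite !patchE/=; case: ifP => // _; rewrite subr0.
Qed.

Lemma Rintegral_restrictM A u v :
  \int[mu]_(x in A) (u x * v x) = \int[mu]_x ((u \_ A) x * v x).
Proof.
rewrite Rintegral_mkcond; apply: eq_Rintegral => x _.
by rewrite !patchE; case: ifP => // _; rewrite mul0r.
Qed.

(* [|u v| <= (u ^ 2 / t + t v ^ 2) / 2] *)
Lemma cauchy_schwarz_AMGM u v (t : R) : 0 < t -> sqint mu u -> sqint mu v ->
  `|\int[mu]_x (u x * v x)| <=
  2^-1 * (t^-1 * fine (energy mu u) + t * fine (energy mu v)).
Proof.
move=> t0 su sv.
have i1 := sqint_integrable su; have i2 := sqint_integrable sv.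
have i3 := sqint_integrableM su sv.
apply: le_trans (le_normr_Rintegral _ i3) _ => //.
have E : 2^-1 * (t^-1 * fine (energy mu u) + t * fine (energy mu v)) =
   \int[mu]_x ((2^-1 * t^-1) * u x ^+ 2 + (2^-1 * t) * v x ^+ 2).
  rewrite RintegralD//; last 2 first.
    exact: (integrableZl measurableT _ i1).
    exact: (integrableZl measurableT _ i2).
  by rewrite !RintegralZl// /Rintegral -/(energy mu u) -/(energy mu v); ring.
rewrite E; apply: le_Rintegral => //.
- exact: integrable_norm.
- exact: (integrableD measurableT (integrableZl measurableT _ i1) (integrableZl measurableT _ i2)).
move=> x _; rewrite normrM -(real_normK (num_real (u x))) -(real_normK (num_real (v x))).
have : 0 <= (`|u x| - t * `|v x|) ^+ 2 by exact: sqr_ge0.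
move: `|u x| `|v x| => a b h.
rewrite -(ler_pM2l t0) mulrDr.
rewrite (_ : t * (2^-1 * t^-1 * a ^+ 2) = 2^-1 * a ^+ 2); last by field; rewrite gt_eqF.
lra.
Qed.

Lemma integral_small (v : T -> R) (w : nat -> T -> R) :
  (forall n, sqint mu (w n)) -> sqint mu v ->
  (forall e : R, 0 < e -> \forall n \near \oo, (energy mu (w n) <= e%:E)%E) ->
  \int[mu]_x (w n x * v x) @[n --> \oo] --> 0.
Proof.
move=> sw sv w0; apply/cvgr0Pnorm_le => e e0.
have V0 : 0 <= fine (energy mu v) by rewrite fine_ge0// energy_ge0.
(* With this weight the term in [v] is at most [e]; so is the other one as soon as the energy of
   [w n] is at most [t * e]. *)
pose t := e / (fine (energy mu v) + 1).
have t0 : 0 < t by rewrite divr_gt0// ltr_wpDl.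
have te : t * fine (energy mu v) <= e.
  by rewrite /t mulrAC -mulrA ger_pMr// ler_pdivrMr ?mul1r ?lerDl// ltr_wpDl.
apply: filterS (w0 (t * e) (mulr_gt0 t0 e0)) => n wn.
apply: le_trans (cauchy_schwarz_AMGM t0 (sw n) sv) _.
have : t^-1 * fine (energy mu (w n)) <= e.
  rewrite ler_pdivrMl// -lee_fin fineK// ge0_fin_numE ?energy_ge0//.
  by case: (sw n).
lra.
Qed.

End L2_energy.

(** * Integration by parts on the rectangle *)

Section rectangle.
Variable R : realType.
Local Notation T := (measurableTypeR R * measurableTypeR R)%type.
Local Notation leb := (@lebesgue_measure R).
Local Notation leb2 := (@plane_measure R).
Implicit Types (p q : R * R) (f g h : R * R -> R).
Variables l1 l2 : R.
Hypothesis l10 : 0 < l1.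
Hypothesis l20 : 0 < l2.
Local Notation Om := (Omega l1 l2).

Lemma measurable_Omega : measurable (Om : set T).
Proof. by apply: measurableX. Qed.

Lemma sqint_indic_Omega : sqint leb2 (\1_Om : T -> R).
Proof.
apply: sqint_indic; first exact: measurable_Omega.
rewrite /= /plane_measure product_measure1E//= !lebesgue_measure_itv/= !lte_fin l10 l20.
by rewrite -!EFinB -EFinM ltry.
Qed.

Lemma continuous_bounded_Omega f : continuous f ->
  exists M, forall p, 0 <= p.1 <= l1 -> 0 <= p.2 <= l2 -> `|f p| <= M.
Proof.
move=> cf.
have cK : compact (`[0, l1] `*` `[0, l2]) by apply: compact_setX; exact: segment_compact.
have [M [Mr HM]] := compact_bounded (continuous_compact (continuous_subspaceT cf) cK).
exists (M + 1) => p p1 p2; apply: HM; first by rewrite ltrDl.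
by exists p => //; split; rewrite /= in_itv.
Qed.

Lemma measurable_restrict_Omega f : continuous f ->
  measurable_fun setT (f \_ Om : T -> R).
Proof.
move=> cf; apply: (measurable_restrictT (f : T -> R) measurable_Omega).1.
exact: (measurable_funTS (continuous_plane_measurable cf)).
Qed.

Lemma sqint_continuous f : continuous f -> sqint leb2 (f \_ Om).
Proof.
move=> cf; have [M fM] := continuous_bounded_Omega cf.
split; first exact: measurable_restrict_Omega.
have M0 : 0 <= M by apply: le_trans (normr_ge0 _) (fM (0, 0) _ _) => /=; rewrite lexx ltW.
have [mM] := sqintZ M sqint_indic_Omega.
apply: le_lt_trans; apply: le_energy => //; first exact: measurable_restrict_Omega.
move=> p; rewrite patchE indicE; case: ifPn => [|_]; last by rewrite mulr0.
rewrite inE mulr1 => -[/=]; rewrite !in_itv/= => /andP[p1 p1'] /andP[p2 p2'].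
by rewrite (ger0_norm M0); apply: fM; rewrite !ltW.
Qed.

Lemma integrable_Omega g : sqint leb2 g -> (forall p, ~ Om p -> g p = 0) ->
  leb2.-integrable setT (EFin \o g).
Proof.
move=> sg gO.
have := sqint_integrableM sg sqint_indic_Omega; congr (integrable _ _).
apply/funext => p /=; have [Op|Op] := pselect (Om p).
  by rewrite indicE mem_set// mulr1.
by rewrite gO// mul0r.
Qed.

Lemma FTC2_segment (F D : R -> R) (l : R) : 0 < l ->
  (forall x, is_derive x (1 : R) F (D x)) -> continuous D ->
  (\int[leb]_(x in `]0%R, l[) (D x)%:E = (F l - F 0)%:E)%E.
Proof.
move=> l0 FD cD.
rewrite -(@integral_itv_bndoo _ _ _ _ true false); last first.
  by apply/measurable_EFinP; apply: measurable_funTS; exact: continuous_measurable_fun.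
have cF : continuous F.
  move=> x; apply/differentiable_continuous/derivable1_diffP.
  by case: (FD x).
rewrite (@continuous_FTC2 _ D F) ?EFinB//.
- exact: continuous_subspaceT.
- split=> [x _||].
  + by case: (FD x).
  + by apply: cvg_at_right_filter; exact: cF.
  + by apply: cvg_at_left_filter; exact: cF.
- by move=> x _; rewrite derive1E derive_val.
Qed.

Lemma integrable_itvoo (f : R -> R) (l : R) : continuous f ->
  leb.-integrable `]0, l[ (EFin \o f).
Proof.
move=> cf; have i : leb.-integrable `[0, l] (EFin \o f).
  by apply: continuous_compact_integrable; [exact: segment_compact|exact: continuous_subspaceT].
apply: integrableS i => //.
by apply: subset_itv; rewrite bnd_simp.
Qed.

Lemma continuous_section1 f y : continuous f -> continuous (fun x => f (x, y)).
Proof.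
move=> cf x; apply: continuous_comp; last exact: cf.
exact: (cvg_pair cvg_id (cvg_cst y)).
Qed.

Lemma continuous_section2 f x : continuous f -> continuous (fun y => f (x, y)).
Proof.
move=> cf y; apply: continuous_comp; last exact: cf.
exact: (cvg_pair (cvg_cst x) cvg_id).
Qed.

Lemma is_derive_section1 f p l : is_derive p ((1, 0) : R * R) f l ->
  is_derive p.1 (1 : R) (fun x => f (x, p.2)) l.
Proof.
move=> [df fl].
have E : (fun t => t^-1 *: ((f \o shift p) (t *: ((1, 0) : R * R)) - f p)) =
    (fun t => t^-1 *: (((fun x => f (x, p.2)) \o shift p.1) (t *: (1 : R)) - (fun x => f (x, p.2)) p.1)).
  apply/funext => t /=; rewrite shift_dx [_ *: (1 : R)]mulr1.
  by rewrite -surjective_pairing.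
by apply: DeriveDef; rewrite /derivable /derive -E.
Qed.

Lemma is_derive_section2 f p l : is_derive p ((0, 1) : R * R) f l ->
  is_derive p.2 (1 : R) (fun y => f (p.1, y)) l.
Proof.
move=> [df fl].
have E : (fun t => t^-1 *: ((f \o shift p) (t *: ((0, 1) : R * R)) - f p)) =
    (fun t => t^-1 *: (((fun y => f (p.1, y)) \o shift p.2) (t *: (1 : R)) - (fun y => f (p.1, y)) p.2)).
  apply/funext => t /=; rewrite shift_dy [_ *: (1 : R)]mulr1.
  by rewrite -surjective_pairing.
by apply: DeriveDef; rewrite /derivable /derive -E.
Qed.

(** Fubini's theorem with the inner integral along x, then the fundamental theorem of calculus on
    each horizontal segment. *)
Lemma integral_dx h h' : continuous h' ->
  (forall p, is_derive p ((1, 0) : R * R) h (h' p)) ->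
  \int[leb2]_p (h' \_ Om) p = \int[leb]_(y in `]0, l2[) (h (l1, y) - h (0, y)).
Proof.
move=> ch' hh'.
have sh' := sqint_continuous ch'.
have ih' : leb2.-integrable setT (EFin \o h' \_ Om).
  by apply: integrable_Omega => // p Op; rewrite patchE memNset.
rewrite /Rintegral; congr fine.
rewrite -[LHS](@integral21_prod_meas1 _ _ _ _ R leb leb (EFin \o h' \_ Om)) //.
rewrite [RHS]integral_mkcond; apply: eq_integral => y _.
rewrite /fubini_G patchE; case: ifPn => yO; last first.
  rewrite -[RHS](integral0 leb setT); apply: eq_integral => x _.
  by rewrite /= patchE memNset// => -[_ /= y1]; move: yO; rewrite notin_setE.
have hd (x : R) : is_derive x (1 : R) (fun x => h (x, y)) (h' (x, y)).
  exact: (is_derive_section1 (hh' (x, y))).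
have c1 : continuous (fun x => h' (x, y)) by exact: continuous_section1.
rewrite -(FTC2_segment l10 hd c1) [RHS]integral_mkcond.
apply: eq_integral => x _; rewrite /= patchE [RHS]patchE.
case: ifPn => [|].
  by rewrite inE => -[xO _]; rewrite mem_set.
case: ifPn => // xO /negP[]; rewrite inE; split; exact/set_mem.
Qed.
Lemma integral_dy h h' : continuous h' ->
  (forall p, is_derive p ((0, 1) : R * R) h (h' p)) ->
  \int[leb2]_p (h' \_ Om) p = \int[leb]_(x in `]0, l1[) (h (x, l2) - h (x, 0)).
Proof.
move=> ch' hh'.
have sh' := sqint_continuous ch'.
have ih' : leb2.-integrable setT (EFin \o h' \_ Om).
  by apply: integrable_Omega => // p Op; rewrite patchE memNset.
rewrite /Rintegral; congr fine.
rewrite -[LHS](@integral12_prod_meas1 _ _ _ _ R leb leb (EFin \o h' \_ Om)) //.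
rewrite [RHS]integral_mkcond; apply: eq_integral => x _.
rewrite /fubini_F patchE; case: ifPn => xO; last first.
  rewrite -[RHS](integral0 leb setT); apply: eq_integral => y _.
  by rewrite /= patchE memNset// => -[/= x1 _]; move: xO; rewrite notin_setE.
have hd (y : R) : is_derive y (1 : R) (fun y => h (x, y)) (h' (x, y)).
  exact: (is_derive_section2 (hh' (x, y))).
have c1 : continuous (fun y => h' (x, y)) by exact: continuous_section2.
rewrite -(FTC2_segment l20 hd c1) [RHS]integral_mkcond.
apply: eq_integral => y _; rewrite /= patchE [RHS]patchE.
case: ifPn => [|].
  by rewrite inE => -[_ yO]; rewrite mem_set.
case: ifPn => // yO /negP[]; rewrite inE; split; exact/set_mem.
Qed.

(* [h = f g] in [integral_dx] and [integral_dy], with [g] vanishing on the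
   right, resp. upper, side of the rectangle. *)
Lemma integration_by_parts_dx f f' g g' : continuous f -> continuous f' ->
  continuous g -> continuous g' ->
  (forall p, is_derive p ((1, 0) : R * R) f (f' p)) ->
  (forall p, is_derive p ((1, 0) : R * R) g (g' p)) ->
  (forall y, g (l1, y) = 0) ->
  \int[leb2]_p ((f \_ Om) p * g' p) + \int[leb2]_p ((f' \_ Om) p * g p) =
  - \int[leb]_(y in `]0, l2[) (f (0, y) * g (0, y)).
Proof.
move=> cf cf' cg cg' ff' gg' g0.
have rM (u v : R * R -> R) p : (u \_ Om) p * v p = ((fun p => u p * v p) \_ Om) p.
  by rewrite !patchE; case: ifP => //; rewrite mul0r.
have iM (u v : R * R -> R) : continuous u -> continuous v ->
    leb2.-integrable setT (EFin \o (fun p => (u \_ Om) p * v p)).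
  move=> cu cv; have cM : continuous (fun p => u p * v p).
    by move=> p; apply: cvgM; [exact: cu|exact: cv].
  have := integrable_Omega (sqint_continuous cM).
  have -> : (fun p => (u \_ Om) p * v p) = ((fun p => u p * v p) \_ Om).
    by apply/funext => p; exact: rM.
  by apply => p Op; rewrite patchE memNset.
rewrite -RintegralD//; [|exact: iM..].
pose h p := f p * g p; pose h' p := f p * g' p + f' p * g p.
have ch' : continuous h'.
  by move=> p; apply: cvgD; apply: cvgM; [exact: cf|exact: cg'|exact: cf'|exact: cg].
have hh' p : is_derive p ((1, 0) : R * R) h (h' p).
  have D := is_deriveM (ff' p) (gg' p).
  by apply: (is_derive_eq D); rewrite /h' /GRing.scale/=; ring.
transitivity (\int[leb2]_p (h' \_ Om) p).
  by apply: eq_Rintegral => p _; rewrite /h' !patchE; case: ifP => //; rewrite !mul0r addr0.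
rewrite (integral_dx ch' hh') -mulN1r -RintegralZl//.
  by apply: eq_Rintegral => y _; rewrite /h g0 mulr0 sub0r mulN1r.
have cb : continuous (fun y => f (0, y) * g (0, y)).
  by move=> y; apply: cvgM; [exact: (@continuous_section2 f 0 cf)|exact: (@continuous_section2 g 0 cg)].
exact: integrable_itvoo.
Qed.

Lemma integration_by_parts_dy f f' g g' : continuous f -> continuous f' ->
  continuous g -> continuous g' ->
  (forall p, is_derive p ((0, 1) : R * R) f (f' p)) ->
  (forall p, is_derive p ((0, 1) : R * R) g (g' p)) ->
  (forall x, g (x, l2) = 0) ->
  \int[leb2]_p ((f \_ Om) p * g' p) + \int[leb2]_p ((f' \_ Om) p * g p) =
  - \int[leb]_(x in `]0, l1[) (f (x, 0) * g (x, 0)).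
Proof.
move=> cf cf' cg cg' ff' gg' g0.
have rM (u v : R * R -> R) p : (u \_ Om) p * v p = ((fun p => u p * v p) \_ Om) p.
  by rewrite !patchE; case: ifP => //; rewrite mul0r.
have iM (u v : R * R -> R) : continuous u -> continuous v ->
    leb2.-integrable setT (EFin \o (fun p => (u \_ Om) p * v p)).
  move=> cu cv; have cM : continuous (fun p => u p * v p).
    by move=> p; apply: cvgM; [exact: cu|exact: cv].
  have := integrable_Omega (sqint_continuous cM).
  have -> : (fun p => (u \_ Om) p * v p) = ((fun p => u p * v p) \_ Om).
    by apply/funext => p; exact: rM.
  by apply => p Op; rewrite patchE memNset.
rewrite -RintegralD//; [|exact: iM..].
pose h p := f p * g p; pose h' p := f p * g' p + f' p * g p.
have ch' : continuous h'.
  by move=> p; apply: cvgD; apply: cvgM; [exact: cf|exact: cg'|exact: cf'|exact: cg].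
have hh' p : is_derive p ((0, 1) : R * R) h (h' p).
  have D := is_deriveM (ff' p) (gg' p).
  by apply: (is_derive_eq D); rewrite /h' /GRing.scale/=; ring.
transitivity (\int[leb2]_p (h' \_ Om) p).
  by apply: eq_Rintegral => p _; rewrite /h' !patchE; case: ifP => //; rewrite !mul0r addr0.
rewrite (integral_dy ch' hh') -mulN1r -RintegralZl//.
  by apply: eq_Rintegral => x _; rewrite /h g0 mulr0 sub0r mulN1r.
have cb : continuous (fun x => f (x, 0) * g (x, 0)).
  by move=> x; apply: cvgM; [exact: (@continuous_section1 f 0 cf)|exact: (@continuous_section1 g 0 cg)].
exact: integrable_itvoo.
Qed.

End rectangle.

(** * Weak derivatives *)

Section weak.
Variable R : realType.
Local Notation T := (measurableTypeR R * measurableTypeR R)%type.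
Local Notation leb := (@lebesgue_measure R).
Local Notation leb2 := (@plane_measure R).
Implicit Types (p q : R * R) (f g h u v : R * R -> R) (a : nat * nat).
Variables l1 l2 : R.
Hypothesis l10 : 0 < l1.
Hypothesis l20 : 0 < l2.
Local Notation Om := (Omega l1 l2).

Definition square_integrable u := sqint leb2 (u \_ Om).

Lemma smooth_continuous f : smooth f -> continuous f.
Proof. by move=> /(_ 0%N)[]. Qed.

Lemma smooth_dx f : smooth f -> smooth (dx f).
Proof. by move=> sf k; have [_ []] := sf k.+1. Qed.

Lemma smooth_dy f : smooth f -> smooth (dy f).
Proof. by move=> sf k; have [_ []] := sf k.+1. Qed.

Lemma smooth_is_derive_dx f p : smooth f -> is_derive p ((1, 0) : R * R) f (dx f p).
Proof. by move=> /(_ 1%N)[_ [+ _ _ _]] => /(_ p) df; apply: DeriveDef. Qed.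

Lemma smooth_is_derive_dy f p : smooth f -> is_derive p ((0, 1) : R * R) f (dy f p).
Proof. by move=> /(_ 1%N)[_ [_ + _ _]] => /(_ p) df; apply: DeriveDef. Qed.

Lemma smooth_pd a f : smooth f -> smooth (pd a f).
Proof.
move=> sf; rewrite /pd; elim: (a.1) => [|n IH]; last exact: smooth_dx.
by elim: (a.2) => [|n IH] //; exact: smooth_dy.
Qed.

Lemma near0_is_derive0 f (v p : R * R) : (\forall q \near p, f q = 0) -> 'D_v f p = 0.
Proof.
move=> f0.
have := @near_eq_derive R _ _ (cst 0) f p v.
by rewrite derive_cst => <-//; apply: filterS f0 => q ->.
Qed.

(** It makes compact sets closed: a test function is then zero near every point off its compact set
    [K], and its derivatives vanish there too. *)
Lemma plane_hausdorff : hausdorff_space (R * R)%type.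
Proof.
move=> p q pq; apply: injective_projections; apply: (@Rhausdorff R) => A B pA qB.
  have [||z [zA zB]] := pq (fst @^-1` A) (fst @^-1` B).
  - exact: (@cvg_fst _ _ (nbhs p.1) (nbhs p.2) _ A pA).
  - exact: (@cvg_fst _ _ (nbhs q.1) (nbhs q.2) _ B qB).
  by exists z.1.
have [||z [zA zB]] := pq (snd @^-1` A) (snd @^-1` B).
- exact: (@cvg_snd _ _ (nbhs p.1) (nbhs p.2) _ A pA).
- exact: (@cvg_snd _ _ (nbhs q.1) (nbhs q.2) _ B qB).
by exists z.2.
Qed.

Lemma test_function_dx f : test_function Om f -> test_function Om (dx f).
Proof.
move=> [sf [K [cK KO f0]]]; split; first exact: smooth_dx.
exists K; split=> // p pK; apply: near0_is_derive0.
have oK : open (~` K) by apply/closed_openC; apply: compact_closed cK; exact: plane_hausdorff.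
by apply: filterS (open_nbhs_nbhs (conj oK pK)) => q /f0.
Qed.

Lemma test_function_dy f : test_function Om f -> test_function Om (dy f).
Proof.
move=> [sf [K [cK KO f0]]]; split; first exact: smooth_dy.
exists K; split=> // p pK; apply: near0_is_derive0.
have oK : open (~` K) by apply/closed_openC; apply: compact_closed cK; exact: plane_hausdorff.
by apply: filterS (open_nbhs_nbhs (conj oK pK)) => q /f0.
Qed.

Lemma is_weak_derivP a u v : is_weak_deriv Om a u v <->
  [/\ square_integrable u, square_integrable v & forall f, test_function Om f ->
    \int[leb2]_p ((u \_ Om) p * pd a f p) =
    (-1) ^+ (a.1 + a.2) * \int[leb2]_p ((v \_ Om) p * f p)].
Proof.
have E (w w' : R * R -> R) : \int[mu2 R]_(p in Om) (w p * w' p) =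
    \int[leb2]_p ((w \_ Om) p * w' p) := Rintegral_restrictM leb2 Om w w'.
split=> -[].
  move=> /L2P su /L2P sv uv; split=> // f tf.
  by have := uv f tf; rewrite !E.
move=> su sv uv; split; [exact/L2P|exact/L2P|] => f tf.
by rewrite !E; exact: uv.
Qed.

Lemma integrable_restrictM u f : square_integrable u -> continuous f ->
  leb2.-integrable setT (fun p => ((u \_ Om) p * f p)%:E).
Proof.
move=> su cf.
have -> : (fun p => ((u \_ Om) p * f p)%:E) = (fun p => ((u \_ Om) p * (f \_ Om) p)%:E).
  apply/funext => p; rewrite !patchE; case: ifP => //; by rewrite !mul0r.
by apply: sqint_integrableM => //; exact: sqint_continuous.
Qed.

Lemma is_weak_derivB a u v u' v' : is_weak_deriv Om a u v ->
  is_weak_deriv Om a u' v' -> is_weak_deriv Om a (u \- u') (v \- v').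
Proof.
move=> /is_weak_derivP[su sv uv] /is_weak_derivP[su' sv' uv']; apply/is_weak_derivP.
split; [by rewrite /square_integrable restrictB; exact: sqintB..|].
move=> f tf; have [sf _] := tf; rewrite !restrictB.
have cf := smooth_continuous sf; have cpf := smooth_continuous (smooth_pd a sf).
under eq_Rintegral do rewrite mulrBl.
rewrite RintegralB//; [|exact: integrable_restrictM..].
under [in RHS]eq_Rintegral do rewrite mulrBl.
rewrite RintegralB//; [|exact: integrable_restrictM..].
by rewrite uv// uv'// mulrBr.
Qed.

Lemma eq_is_weak_deriv a u v u' v' : (forall p, Om p -> u p = u' p) ->
  (forall p, Om p -> v p = v' p) ->
  is_weak_deriv Om a u v -> is_weak_deriv Om a u' v'.
Proof.
move=> uu' vv'.
have E (w w' : R * R -> R) : (forall p, Om p -> w p = w' p) -> w \_ Om = w' \_ Om.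
  move=> ww'; apply/funext => p; rewrite !patchE; case: ifP => //.
  by rewrite inE => /ww'.
move=> /is_weak_derivP h; apply/is_weak_derivP.
by rewrite /square_integrable -(E _ _ uu') -(E _ _ vv').
Qed.

Lemma is_weak_deriv00 u : square_integrable u -> is_weak_deriv Om (0%N, 0%N) u u.
Proof. by move=> su; apply/is_weak_derivP; split=> // f _; rewrite expr0 mul1r. Qed.

(** This holds for every [u] and [a], thanks to the default value 0 of [wd]. *)
Lemma square_integrable_wd a u : square_integrable (wd Om a u).
Proof.
rewrite /wd; case: xgetP => [v _ /is_weak_derivP[_ sv _]//|_].
by apply: sqint_continuous => // p; exact: cvg_cst.
Qed.

Lemma wdP a u v : is_weak_deriv Om a u v -> is_weak_deriv Om a u (wd Om a u).
Proof. by rewrite /wd => h; case: xgetP => [//|/(_ v)]. Qed.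

Lemma Omega_sides f : (exists K, [/\ compact K, K `<=` Om & forall p, ~ K p -> f p = 0]) ->
  (forall y, f (l1, y) = 0 /\ f (0, y) = 0) /\ (forall x, f (x, l2) = 0 /\ f (x, 0) = 0).
Proof.
move=> [K [_ KO f0]]; split=> z; split; apply: f0 => /KO[/=]; rewrite !in_itv/=.
- by rewrite ltxx andbF.
- by rewrite ltxx.
- by rewrite ltxx andbF.
- by rewrite ltxx.
Qed.

Lemma test_function_integral_dx f g : smooth f -> test_function Om g ->
  \int[leb2]_p ((f \_ Om) p * dx g p) = - \int[leb2]_p ((dx f \_ Om) p * g p).
Proof.
move=> sf [sg /Omega_sides[g1 g2]].
apply/eqP; rewrite -subr_eq0 opprK.
rewrite (integration_by_parts_dx l10 l20 (smooth_continuous sf)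
  (smooth_continuous (smooth_dx sf)) (smooth_continuous sg)
  (smooth_continuous (smooth_dx sg)) (fun p => smooth_is_derive_dx p sf)
  (fun p => smooth_is_derive_dx p sg) (fun z => (g1 z).1)) oppr_eq0.
under eq_Rintegral do rewrite (g1 _).2 mulr0.
by rewrite Rintegral_cst ?mul0r.
Qed.

Lemma test_function_integral_dy f g : smooth f -> test_function Om g ->
  \int[leb2]_p ((f \_ Om) p * dy g p) = - \int[leb2]_p ((dy f \_ Om) p * g p).
Proof.
move=> sf [sg /Omega_sides[g1 g2]].
apply/eqP; rewrite -subr_eq0 opprK.
rewrite (integration_by_parts_dy l10 l20 (smooth_continuous sf)
  (smooth_continuous (smooth_dy sf)) (smooth_continuous sg)
  (smooth_continuous (smooth_dy sg)) (fun p => smooth_is_derive_dy p sf)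
  (fun p => smooth_is_derive_dy p sg) (fun z => (g2 z).1)) oppr_eq0.
under eq_Rintegral do rewrite (g2 _).2 mulr0.
by rewrite Rintegral_cst ?mul0r.
Qed.

(* Transferring first the derivatives in x, which are the outermost ones in
   [pd], then those in y, reverses their order. *)
Lemma smooth_weak_deriv a f : smooth f ->
  is_weak_deriv Om a f (iter a.2 (@dy R) (iter a.1 (@dx R) f)).
Proof.
move=> sf.
have sx n : smooth (iter n (@dx R) f) by elim: n => [//|n IH]; exact: smooth_dx.
have sy n : smooth (iter n (@dy R) (iter a.1 (@dx R) f)).
  by elim: n => [|n IH]; [exact: sx|exact: smooth_dy].
apply/is_weak_derivP; split.
- exact/sqint_continuous/smooth_continuous.
- exact/sqint_continuous/smooth_continuous.
move=> g tg.
have ty n : test_function Om (iter n (@dy R) g).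
  by elim: n => [//|n IH]; exact: test_function_dy.
have Ex n h k : smooth h -> test_function Om k ->
    \int[leb2]_p ((h \_ Om) p * iter n (@dx R) k p) =
    (-1) ^+ n * \int[leb2]_p ((iter n (@dx R) h \_ Om) p * k p).
  elim: n h k => [|n IH] h k sh tk; first by rewrite expr0 mul1r.
  have tn : test_function Om (iter n (@dx R) k).
    by elim: n {IH} => [//|n IHn]; exact: test_function_dx.
  rewrite iterS test_function_integral_dx// IH//; last exact: smooth_dx.
  by rewrite -iterSr exprS mulN1r mulNr.
have Ey n h k : smooth h -> test_function Om k ->
    \int[leb2]_p ((h \_ Om) p * iter n (@dy R) k p) =
    (-1) ^+ n * \int[leb2]_p ((iter n (@dy R) h \_ Om) p * k p).
  elim: n h k => [|n IH] h k sh tk; first by rewrite expr0 mul1r.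
  have tn : test_function Om (iter n (@dy R) k).
    by elim: n {IH} => [//|n IHn]; exact: test_function_dy.
  rewrite iterS test_function_integral_dy// IH//; last exact: smooth_dy.
  by rewrite -iterSr exprS mulN1r mulNr.
by rewrite /pd Ex// Ey// mulrA -exprD.
Qed.

(** * Uniqueness of weak derivatives *)

Section uniqueness.
Variables (e : nat -> R) (m : nat -> nat -> R -> R).
Hypothesis e0 : forall n, 0 < e n.
Hypothesis cvg_e : e n @[n --> \oo] --> 0.
Hypothesis mm : forall n, mollifier (e n) (m n).

(** The kernel as a function of its integration variable; the signs are those of the chain rule. *)
Lemma jet_reflect (b : nat -> R -> R) (x : R) : jet b ->
  jet (fun n y => (-1) ^+ n * b n (x - y)).
Proof.
move=> jb; split=> [n y|n]; last first.
  have [M bM] := jet_bounded jb n; exists M => y.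
  by rewrite normrM normrX normrN1 expr1n mul1r.
have d1 : is_derive y (1 : R) (fun y => x - y) (-1).
  have := is_deriveB (is_derive_cst x y (1 : R)) (is_derive_id y (1 : R)).
  by rewrite sub0r.
have d2 := @is_derive1_comp R (b n) _ y _ _ (jet_derive jb n (x - y)) d1.
have := is_deriveZ ((-1) ^+ n) d2 => d3.
apply: (is_derive_eq d3).
by rewrite /GRing.scale/= exprS; ring.
Qed.

(** The support in each variable lies between [2 * e n] and [e n] below the coordinate of [p], so
    room is required only on the left and below. *)
Lemma kernel_test_function n (p : R * R) : 2 * e n < p.1 < l1 -> 2 * e n < p.2 < l2 ->
  test_function Om (product_kernel (m n) p).
Proof.
move=> /andP[p1 p1'] /andP[p2 p2'].
have jm := mollifier_jet (mm n).
have -> : product_kernel (m n) p = tensor (fun i y => (-1) ^+ i * m n i (p.1 - y))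
    (fun i y => (-1) ^+ i * m n i (p.2 - y)) (0%N, 0%N).
  by apply/funext => q; rewrite /product_kernel /tensor/= !expr0 !mul1r.
have j1 := jet_reflect p.1 jm; have j2 := jet_reflect p.2 jm.
split.
  apply: (@smooth_family R (tensor _ _)).
  - by move=> i; exact: tensor_continuous.
  - by move=> i q; exact: tensor_dx.
  - by move=> i q; exact: tensor_dy.
exists (`[p.1 - 2 * e n, p.1 - e n] `*` `[p.2 - 2 * e n, p.2 - e n]); split.
- by apply: compact_setX; exact: segment_compact.
- have := e0 n => en0 q [/=]; rewrite !in_itv/= => /andP[q1 q1'] /andP[q2 q2'].
  by split; rewrite /= in_itv/=; apply/andP; split; lra.
- move=> q qK; apply/eqP; apply: contra_notT qK => kq.
  have kq' : product_kernel (m n) p q != 0.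
    by move: kq; rewrite /product_kernel /tensor/= !expr0 !mul1r.
  have [h1 h2 h3 h4] := kernel_support (mm n) kq'.
  by split; rewrite /= in_itv/= ?h1 ?h2 ?h3.
Qed.

(* The averages of [u] vanish at every point of the rectangle, as soon as the
   support of the kernel around it is inside of the rectangle. *)
Lemma fundamental_lemma u : square_integrable u ->
  (forall f, test_function Om f -> \int[leb2]_p ((u \_ Om) p * f p) = 0) ->
  energy leb2 (u \_ Om) = 0%E.
Proof.
move=> su u0; pose g := u \_ Om.
have gO p : ~ Om p -> g p = 0 by move=> Op; rewrite /g patchE memNset.
have [_ cg] := average_cvg_plane e0 cvg_e mm su gO.
(* Once [2 * e n < d], the averages vanish on [D d], so the energy of [g] there is bounded by that
   of the error of averaging. These rectangles exhaust Omega as [d] tends to 0. *)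
pose D (d : R) := `]d, l1[%classic `*` `]d, l2[%classic : set T.
have mD d : measurable (D d) by exact: measurableX.
have mg : measurable_fun setT (g : T -> R) by case: su.
have mgD d : measurable_fun setT (g \_ (D d) : T -> R).
  by apply: (measurable_restrictT (g : T -> R) (mD d)).1; exact: measurable_funTS.
have gD0 d : 0 < d -> energy leb2 (g \_ (D d)) = 0%E.
  move=> d0; apply/eqP; rewrite eq_le energy_ge0 andbT.
  apply/lee_addgt0Pr => r r0; rewrite add0e.
  have d2 : 0 < d / 2 by rewrite divr_gt0.
  have [N _ HN] := filterI (cg r r0) (cvgr_lt 0 cvg_e _ d2).
  have [cN eN] := HN N (leqnn N).
  apply: le_trans cN.
  have mA : measurable_fun setT (average leb2 (product_kernel (m N)) g).
    exact: (measurable_average (kernel_averaging (mm N)) mg).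
  apply: le_energy => //; first exact: measurable_funB.
  move=> p; rewrite patchE; case: ifPn => [|_]; last by rewrite normr0.
  rewrite inE => -[/=]; rewrite !in_itv/= => /andP[p1 p1'] /andP[p2 p2'].
  rewrite [average _ _ _ _](_ : _ = 0) ?sub0r ?normrN//.
  rewrite /average -[RHS](u0 (product_kernel (m N) p)).
    by apply: eq_Rintegral => q _; rewrite mulrC.
  by apply: kernel_test_function; apply/andP; split=> //; lra.
have h n := gD0 n.+1%:R^-1 (_ : 0 < n.+1%:R^-1).
have /= [] := @dominated_convergence _ _ _ leb2 setT measurableT
  (fun n p => ((g \_ (D n.+1%:R^-1)) p ^+ 2)%:E)
  (fun p => (g p ^+ 2)%:E) (fun p => (g p ^+ 2)%:E).
- by move=> n; exact: measurable_sqr.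
- exact: measurable_sqr.
- apply: aeW => p _; apply: cvg_near_cst.
  have [[/=]|Op] := pselect (Om p); last first.
    by apply: nearW => n; rewrite patchE (gO _ Op) if_same.
  rewrite !in_itv/= => /andP[p1 p1'] /andP[p2 p2'].
  apply: filterS2 (near_infty_natSinv_lt (PosNum p1)) (near_infty_natSinv_lt (PosNum p2)).
  move=> n /= n1 n2; rewrite patchE mem_set//.
  by split; rewrite /= in_itv/= ?n1 ?n2.
- exact: sqint_integrable.
- apply: aeW => p n _ /=; rewrite patchE; case: ifPn => _.
    by rewrite lee_fin ger0_norm ?sqr_ge0.
  by rewrite expr0n/= normr0 lee_fin sqr_ge0.
move=> _ _; under eq_fun do rewrite -/(energy _ _) h ?invr_gt0//.
move=> c; have := @cvg_unique _ (@ereal_hausdorff R) _ _ _ _ c (cvg_cst 0%E).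
by move=> <-.
Qed.

(** The difference is a weak derivative of [u - u = 0]. Zero energy expresses equality almost
    everywhere on Omega. *)
Lemma weak_deriv_unique a u v v' : is_weak_deriv Om a u v ->
  is_weak_deriv Om a u v' -> energy leb2 ((v \- v') \_ Om) = 0%E.
Proof.
move=> uv uv'; have /is_weak_derivP[s0 sv] := is_weak_derivB uv uv'.
have -> : (u \- u) = cst 0 by apply/funext => p; rewrite /= subrr.
move=> h; apply: fundamental_lemma => // f tf.
have := h f tf; under eq_Rintegral do rewrite patchE if_same mul0r.
rewrite Rintegral_cst// mul0r => /esym/eqP; rewrite mulf_eq0 signr_eq0/=.
by move/eqP.
Qed.

End uniqueness.
End weak.

Lemma cvge0_sqr_le (R : realType) (u : nat -> \bar R) (e : R) : 0 < e ->
  (forall n, 0 <= u n)%E -> u n @[n --> \oo] --> 0%E ->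
  \forall n \near \oo, (u n ^+ 2 <= e%:E)%E.
Proof.
move=> e0 u0 cu.
(* Below 1, a square is at most the number itself. *)
have d0 : 0 < Num.min 1 e by rewrite lt_min ltr01.
apply: filterS (cvge0_lt d0 cu) => n; have := u0 n.
case: (u n) => [r| |]//; rewrite lee_fin lte_fin lt_min => r0 /andP[r1 re].
by rewrite -EFin_expe lee_fin; nra.
Qed.

Section energy0.
Context d (T : measurableType d) (R : realType).
Variable mu : {measure set T -> \bar R}.
Implicit Types (u v : T -> R).

Lemma energy0_integral u v : sqint mu u -> sqint mu v -> energy mu u = 0%E ->
  \int[mu]_x (u x * v x) = 0.
Proof.
move=> su sv u0.
have := @integral_small _ T R mu v (fun=> u) (fun=> su) sv.
have h e : 0 < e -> \forall n \near \oo, (energy mu u <= e%:E)%E.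
  by move=> e0; apply: nearW => _; rewrite u0 lee_fin ltW.
move=> /(_ h) c; exact: (@cvg_unique _ (@Rhausdorff R) _ _ _ _ (cvg_cst _) c).
Qed.

(** The two energies are in fact equal; the factor 2 is harmless in the limits where this is used
    and makes it a case of [energyD]. *)
Lemma energyB0_le u v : measurable_fun setT u -> measurable_fun setT v ->
  energy mu (fun x => u x - v x) = 0%E -> (energy mu u <= 2%:E * energy mu v)%E.
Proof.
move=> mu_ mv uv0.
have -> : u = (fun x => (u x - v x) + v x) by apply/funext => x; rewrite subrK.
apply: le_trans (energyD _ _ _) _ => //; first exact: measurable_funB.
by rewrite uv0 add0e; apply: lee_wpmul2l => //; under eq_fun do rewrite subrK.
Qed.

End energy0.

(** * Energies and Sobolev norms *)

Section Hnorm.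
Variable R : realType.
Local Notation leb2 := (@plane_measure R).
Implicit Types (u : R * R -> R) (a : nat * nat) (O : set (R * R)).

Lemma Hnorm_ge0 O m u : (0 <= Hnorm O m u)%E.
Proof. exact: poweR_ge0. Qed.

Lemma Hnorm_sqr O m u : (Hnorm O m u ^+ 2 =
  \sum_(i < m.+1) \sum_(j < m.+1 | (i + j <= m)%N)
    energy leb2 (wd O (nat_of_ord i, nat_of_ord j) u \_ O))%E.
Proof.
rewrite -poweR_sqr ?Hnorm_ge0// /Hnorm -poweRrM mulVf// poweRe1.
  by apply: eq_bigr => i _; apply: eq_bigr => j _; rewrite L2norm_sqr.
by apply: sume_ge0 => i _; apply: sume_ge0 => j _; rewrite L2norm_sqr energy_ge0.
Qed.

Lemma energy_wd_le_Hnorm O m a u : (a.1 + a.2 <= m)%N ->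
  (energy leb2 (wd O a u \_ O) <= Hnorm O m u ^+ 2)%E.
Proof.
case: a => i j ijm; rewrite Hnorm_sqr; rewrite /= in ijm.
have im : (i < m.+1)%N by rewrite ltnS (leq_trans (leq_addr _ _) ijm).
have jm : (j < m.+1)%N by rewrite ltnS (leq_trans (leq_addl _ _) ijm).
rewrite (bigD1 (Ordinal im))//= (bigD1 (Ordinal jm))//=.
rewrite -addeA leeDl// adde_ge0//.
  by apply: sume_ge0 => k _; exact: energy_ge0.
by apply: sume_ge0 => k _; apply: sume_ge0 => l _; exact: energy_ge0.
Qed.

(** There are at most [(m + 1) ^ 2] orders, so the squared norm is at most [(e / 2) ^ 2]; the spare
    factor 2 gives the strict inequality. *)
Lemma Hnorm_lt O m u (e : R) : 0 < e ->
  (forall a, (a.1 + a.2 <= m)%N ->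
    (energy leb2 (wd O a u \_ O) <= ((e / (2 * m.+1%:R)) ^+ 2)%:E)%E) ->
  (Hnorm O m u < e%:E)%E.
Proof.
move=> e0 ue.
have : (Hnorm O m u ^+ 2 <= ((e / 2) ^+ 2)%:E)%E.
  rewrite Hnorm_sqr.
  apply: (@le_trans _ _ (\sum_(i < m.+1) \sum_(j < m.+1)
      ((e / (2 * m.+1%:R)) ^+ 2)%:E)%E).
    apply: lee_sum => i _.
    rewrite big_mkcond/=; apply: lee_sum => j _.
    by case: ifP => [ij|_]; [exact: ue|rewrite lee_fin sqr_ge0].
  rewrite (eq_bigr (fun=> (\sum_(j < m.+1) (e / (2 * m.+1%:R)) ^+ 2)%:E)); last first.
    by move=> i _; rewrite sumEFin.
  rewrite sumEFin lee_fin !sumr_const !card_ord -mulrnA -[X in X <= _]mulr_natl natrM.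
  rewrite le_eqVlt; apply/orP; left; apply/eqP; field.
  by rewrite addrC natr1 pnatr_eq0.
have := Hnorm_ge0 O m u; case: (Hnorm O m u) => [r| |]//.
rewrite lee_fin -EFin_expe !lee_fin lte_fin => r0 re; nra.
Qed.

End Hnorm.

(** * Functions with zero traces *)

Section trace.
Variable R : realType.
Local Notation T := (measurableTypeR R * measurableTypeR R)%type.
Local Notation leb := (@lebesgue_measure R).
Local Notation leb2 := (@plane_measure R).
Implicit Types (p q : R * R) (f g h u v w : R * R -> R) (a : nat * nat).
Variables l1 l2 : R.
Hypothesis l10 : 0 < l1.
Hypothesis l20 : 0 < l2.
Local Notation Om := (Omega l1 l2).
Variables (e : nat -> R) (m : nat -> nat -> R -> R).
Hypothesis e0 : forall n, 0 < e n.
Hypothesis cvg_e : e n @[n --> \oo] --> 0.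
Hypothesis mm : forall n, mollifier (e n) (m n).

Lemma restrictMr u v p : (u \_ Om) p * v p = (u \_ Om) p * (v \_ Om) p.
Proof. by rewrite !patchE; case: ifP => //; rewrite !mul0r. Qed.

Lemma square_integrable_sub u v : square_integrable l1 l2 u ->
  square_integrable l1 l2 v -> square_integrable l1 l2 (u \- v).
Proof. by move=> su sv; rewrite /square_integrable restrictB; exact: sqintB. Qed.

(** Norms are defined by the choice [wd], estimates are made on explicit weak derivatives: the two
    halves pass from one to the other, by uniqueness. *)
Lemma energy_wd_eq a u v : is_weak_deriv Om a u v ->
  (energy leb2 (v \_ Om) <= 2%:E * energy leb2 (wd Om a u \_ Om))%E /\
  (energy leb2 (wd Om a u \_ Om) <= 2%:E * energy leb2 (v \_ Om))%E.
Proof.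
move=> uv; have uw := wdP uv.
have sv : square_integrable l1 l2 v by case/is_weak_derivP: uv.
have sw : square_integrable l1 l2 (wd Om a u) by case/is_weak_derivP: uw.
have h1 := weak_deriv_unique l10 l20 e0 cvg_e mm uv uw.
have h2 := weak_deriv_unique l10 l20 e0 cvg_e mm uw uv.
rewrite restrictB in h1; rewrite restrictB in h2.
by split; apply: energyB0_le => //; [case: sv|case: sw|case: sw|case: sv].
Qed.

(* Both sides are approximated by those for the smooth functions [f n] of
   [is_trace], for which the formula has a boundary term, which tends to 0. *)
Lemma trace0_integration_by_parts (D : (R * R -> R) -> R * R -> R) a
    (gam : R -> R * R) (l : R) w w' g g' : (a.1 + a.2 <= 1)%N ->
  (forall f, smooth f -> is_weak_deriv Om a f (D f)) ->
  continuous gam -> (forall t, `]0, l[%classic t -> closure Om (gam t)) ->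
  continuous g -> continuous g' ->
  (forall f, smooth f ->
    \int[leb2]_p ((f \_ Om) p * g' p) + \int[leb2]_p ((D f \_ Om) p * g p) =
    - \int[leb]_(t in `]0, l[) (f (gam t) * g (gam t))) ->
  is_trace Om gam `]0, l[%classic w (fun=> 0) -> is_weak_deriv Om a w w' ->
  \int[leb2]_p ((w \_ Om) p * g' p) = - \int[leb2]_p ((w' \_ Om) p * g p).
Proof.
move=> a1 DP cgam Ogam cg cg' ibp [_ _ [f [sf fw f0]]] ww'.
(* [f n] is only known to agree with a smooth function on the closure of Omega, which contains the
   side; that function replaces it. *)
have [h hf] : exists h : nat -> R * R -> R, forall n,
    smooth (h n) /\ forall p, closure Om p -> f n p = h n p.
  by exists (fun n => s2val (cid2 (sf n))) => n; case: cid2.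
have sh n : smooth (h n) by case: (hf n).
have fhO n p : Om p -> h n p = f n p.
  by move=> Op; case: (hf n) => _ ->//; exact: subset_closure.
have sw : square_integrable l1 l2 w by case/is_weak_derivP: ww'.
have sw' : square_integrable l1 l2 w' by case/is_weak_derivP: ww'.
have shn n : square_integrable l1 l2 (h n).
  exact/sqint_continuous/smooth_continuous.
have sDh n : square_integrable l1 l2 (D (h n)) by case/is_weak_derivP: (DP _ (sh n)).
have A0 n : is_weak_deriv Om (0%N, 0%N) (f n \- w) (h n \- w).
  apply: (@eq_is_weak_deriv _ _ _ _ (h n \- w) (h n \- w)) => //.
    by move=> p /fhO /= ->.
  exact/is_weak_deriv00/square_integrable_sub.
have A1 n : is_weak_deriv Om a (f n \- w) (D (h n) \- w').
  apply: is_weak_derivB => //.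
  by apply: eq_is_weak_deriv (DP _ (sh n)) => // p /fhO.
have H2 (r : R) : 0 < r -> \forall n \near \oo, (Hnorm Om 1 (f n \- w)%R ^+ 2 <= r%:E)%E.
  by move=> r0; apply: cvge0_sqr_le => // n; exact: Hnorm_ge0.
have small b (v : nat -> R * R -> R) : (b.1 + b.2 <= 1)%N ->
    (forall n, is_weak_deriv Om b (f n \- w) (v n)) ->
    forall r : R, 0 < r -> \forall n \near \oo, (energy leb2 (v n \_ Om) <= r%:E)%E.
  move=> b1 bv r r0; have r2 : 0 < r / 2 by rewrite divr_gt0.
  apply: filterS (H2 _ r2) => n nr.
  apply: le_trans (energy_wd_eq (bv n)).1 _.
  apply: (@le_trans _ _ (2%:E * (r / 2)%:E)%E).
    by apply: lee_wpmul2l => //; apply: le_trans nr; exact: energy_wd_le_Hnorm.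
  by rewrite -EFinM lee_fin mulrCA divff ?mulr1.
have c0 : \int[leb2]_p (((h n \- w) \_ Om) p * (g' \_ Om) p) @[n --> \oo] --> 0.
  apply: integral_small; [|exact: sqint_continuous|exact: (small (0%N, 0%N))].
  by move=> n; exact: square_integrable_sub.
have c1 : \int[leb2]_p (((D (h n) \- w') \_ Om) p * (g \_ Om) p) @[n --> \oo] --> 0.
  apply: integral_small; [|exact: sqint_continuous|exact: (small a)].
  by move=> n; exact: square_integrable_sub.
pose I := `]0, l[%classic : set R.
have cI (k : R * R -> R) : continuous k -> sqint leb ((k \o gam) \_ I).
  move=> ck; have ckg : continuous (k \o gam).
    by move=> t; apply: continuous_comp; [exact: cgam|exact: ck].
  split.
    apply: (measurable_restrictT (k \o gam : measurableTypeR R -> R) (measurable_itv _)).1.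
    by apply: measurable_funTS; exact: continuous_measurable_fun.
  have ckg2 : continuous (fun t => k (gam t) ^+ 2).
    by move=> t; rewrite /= ; apply: (@continuous_comp _ _ _ (k \o gam) (fun x => x ^+ 2)); [exact: ckg|exact: exprn_continuous].
  have /integrableP[_] := @integrable_itvoo R (fun t => k (gam t) ^+ 2) l ckg2.
  apply: le_lt_trans; rewrite [leRHS]integral_mkcond /energy.
  rewrite le_eqVlt; apply/orP; left; apply/eqP; apply: eq_integral => t _.
  rewrite !patchE; case: ifP => _; last by rewrite expr0n.
  by rewrite /= ger0_norm ?sqr_ge0.
have c2 : \int[leb]_t (((h n \o gam) \_ I) t * ((g \o gam) \_ I) t) @[n --> \oo] --> 0.
  apply: integral_small.
  - by move=> n; apply: cI; exact: smooth_continuous.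
  - exact: cI.
  - move=> r r0; have fN n : (0 <= L2norm (mu1 R) I ((f n \o gam) \- (fun=> 0))%R)%E.
      exact: Lnorm_ge0.
    apply: filterS (cvge0_sqr_le r0 fN f0) => n.
    rewrite L2norm_sqr; congr (_ <= _)%E; congr (energy leb _).
    apply/funext => t; rewrite !patchE; case: ifPn => //.
    by rewrite inE => /Ogam It; rewrite /= subr0; case: (hf n) => _ ->.
apply/eqP; rewrite -subr_eq0; apply/eqP.
set L := (X in X = 0).
have iM (k v : R * R -> R) : square_integrable l1 l2 k -> continuous v ->
  leb2.-integrable setT (EFin \o (fun p => (k \_ Om) p * v p)).
  exact: integrable_restrictM.
pose A n := \int[leb2]_p (((h n \- w) \_ Om) p * (g' \_ Om) p).
pose B n := \int[leb2]_p (((D (h n) \- w') \_ Om) p * (g \_ Om) p).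
pose C n := \int[leb]_t (((h n \o gam) \_ I) t * ((g \o gam) \_ I) t).
(* The defect [L] of the formula for [w] does not depend on [n], while the two interior errors and
   the boundary term tend to 0. *)
have LE n : L = - (A n + B n + C n).
  rewrite /A /B /C.
  under [X in - (X + _ + _)]eq_Rintegral do rewrite -restrictMr restrictB mulrBl.
  under [X in - (_ + X + _)]eq_Rintegral do rewrite -restrictMr restrictB mulrBl.
  rewrite RintegralB//; [|exact: iM|exact: iM].
  rewrite RintegralB//; [|exact: iM|exact: iM].
  have hI : \int[leb]_(t in `]0, l[) (h n (gam t) * g (gam t)) =
    \int[leb]_t (((h n \o gam) \_ I) t * ((g \o gam) \_ I) t).
    rewrite Rintegral_mkcond; apply: eq_Rintegral => t _.
    by rewrite !patchE; case: ifP => //; rewrite mul0r.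
  have alg (x y x1 y1 x2 : R) : x1 + y1 = - x2 -> x + y = - ((x1 - x) + (y1 - y) + x2).
    by move=> xy; have -> : x2 = - (x1 + y1); [by rewrite xy opprK|ring].
  have := ibp _ (sh n); rewrite hI /L opprK => /alg; exact.
have cL : - (A n + B n + C n) @[n --> \oo] --> - (0 + 0 + 0) :=
  cvgN (cvgD (cvgD c0 c1) c2).
have {}cL : L @[_ --> \oo] --> (0 : R).
  have -> : (fun=> L) = (fun n => - (A n + B n + C n)) by apply/funext => n; exact: LE.
  rewrite !addr0 oppr0 in cL. exact: cL.
exact: (@cvg_unique _ (@Rhausdorff R) _ _ _ _ (cvg_cst _) cL).
Qed.

End trace.

(** * Moving derivatives from one-sided kernels to functions with zero traces *)

Section HGamma.
Variable R : realType.
Local Notation T := (measurableTypeR R * measurableTypeR R)%type.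
Local Notation leb := (@lebesgue_measure R).
Local Notation leb2 := (@plane_measure R).
Implicit Types (p q : R * R) (f g h u v w : R * R -> R) (a : nat * nat).
Variables l1 l2 : R.
Hypothesis l10 : 0 < l1.
Hypothesis l20 : 0 < l2.
Local Notation Om := (Omega l1 l2).
Variables (e : nat -> R) (m : nat -> nat -> R -> R).
Hypothesis e0 : forall n, 0 < e n.
Hypothesis cvg_e : e n @[n --> \oo] --> 0.
Hypothesis mm : forall n, mollifier (e n) (m n).

Lemma Rintegral_restrict_ae u v f : square_integrable l1 l2 u ->
  square_integrable l1 l2 v -> continuous f -> energy leb2 ((u \- v) \_ Om) = 0%E ->
  \int[leb2]_p ((u \_ Om) p * f p) = \int[leb2]_p ((v \_ Om) p * f p).
Proof.
move=> su sv cf uv.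
apply/eqP; rewrite -subr_eq0 -RintegralB//; [|exact: integrable_restrictM..].
under eq_Rintegral do rewrite -mulrBl.
rewrite restrictB in uv.
under eq_Rintegral do rewrite mulrBl restrictMr [X in _ - X]restrictMr -mulrBl.
apply/eqP; apply: energy0_integral => //; first exact: sqintB.
exact: sqint_continuous.
Qed.

Lemma closure_Omega_left (y : R) : `]0, l2[%classic y -> closure Om (0, y).
Proof.
move=> y0 B nB.
have cp : (t, y) @[t --> (0 : R)] --> ((0, y) : R * R) by exact: (cvg_pair cvg_id (cvg_cst y)).
near ((0 : R)^'+) => t.
exists (t, y); split; last first.
  by near: t; apply: cvg_at_right_filter cp _ nB.
split => //=; rewrite in_itv/=; apply/andP; split; near: t.
  exact: nbhs_right_gt.
exact: nbhs_right_lt.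
Unshelve. all: by end_near. Qed.

Lemma closure_Omega_bottom (x : R) : `]0, l1[%classic x -> closure Om (x, 0).
Proof.
move=> x0 B nB.
have cp : (x, t) @[t --> (0 : R)] --> ((x, 0) : R * R) by exact: (cvg_pair (cvg_cst x) cvg_id).
near ((0 : R)^'+) => t.
exists (x, t); split; last first.
  by near: t; apply: cvg_at_right_filter cp _ nB.
split => //=; rewrite in_itv/=; apply/andP; split; near: t.
  exact: nbhs_right_gt.
exact: nbhs_right_lt.
Unshelve. all: by end_near. Qed.

(** By definition of [pd], in which [dy] acts first, [pd (i, 0) (dx f)] is [pd (i.+1, 0) f]; with
    derivatives in y present, partial derivatives would have to commute. In [wd_dy] the new [dy] is
    innermost and the order in x is arbitrary. *)
Lemma wd_dx u (i : nat) : (exists v, is_weak_deriv Om (i, 0%N) u v) ->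
  (exists v, is_weak_deriv Om (i.+1, 0%N) u v) ->
  is_weak_deriv Om (1%N, 0%N) (wd Om (i, 0%N) u) (wd Om (i.+1, 0%N) u).
Proof.
move=> [v /wdP[_ Lv hv]] [v' /wdP[_ Lv' hv']]; split => // f tf.
have := hv _ (test_function_dx tf); rewrite /pd /= -iterSr.
rewrite (hv' _ tf : _ = _) /= !addn0 exprS -mulrA => h.
apply: (@mulfI _ ((-1) ^+ i)); first by rewrite signr_eq0.
by rewrite -h expr1 mulrCA.
Qed.

Lemma wd_dy u (i j : nat) : (exists v, is_weak_deriv Om (i, j) u v) ->
  (exists v, is_weak_deriv Om (i, j.+1) u v) ->
  is_weak_deriv Om (0%N, 1%N) (wd Om (i, j) u) (wd Om (i, j.+1) u).
Proof.
move=> [v /wdP[_ Lv hv]] [v' /wdP[_ Lv' hv']]; split => // f tf.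
have := hv _ (test_function_dy tf); rewrite /pd /= -iterSr.
rewrite (hv' _ tf : _ = _) /= addnS exprS -mulrA => h.
apply: (@mulfI _ ((-1) ^+ (i + j))); first by rewrite signr_eq0.
by rewrite -h add0n expr1 mulrCA.
Qed.

Section tensor_test.
Variables b c : nat -> R -> R.
Hypothesis jb : jet b.
Hypothesis jc : jet c.
Hypothesis b0 : forall n, b n l1 = 0.
Hypothesis c0 : forall n, c n l2 = 0.
Local Notation t := (tensor b c).

(** The boundary term on the right side is removed by the zeros of [b], the one on the left side by
    the zero trace of [w]. *)
Lemma trace0_tensor_dx w w' (i j : nat) : trace0 l1 l2 w ->
  is_weak_deriv Om (1%N, 0%N) w w' ->
  \int[leb2]_p ((w \_ Om) p * t (i.+1, j) p) = - \int[leb2]_p ((w' \_ Om) p * t (i, j) p).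
Proof.
move=> [tw _] ww'.
apply: (trace0_integration_by_parts l10 l20 e0 cvg_e mm (D := @dx R)) tw ww' => //.
- by move=> f sf; exact: (smooth_weak_deriv l10 l20 (1%N, 0%N)).
- by move=> y; exact: (cvg_pair (cvg_cst 0) cvg_id).
- exact: closure_Omega_left.
- exact: tensor_continuous.
- exact: tensor_continuous.
move=> f sf.
apply: (integration_by_parts_dx l10 l20 (smooth_continuous sf)
  (smooth_continuous (smooth_dx sf))).
- exact: tensor_continuous.
- exact: tensor_continuous.
- by move=> p; exact: smooth_is_derive_dx.
- by move=> p; exact: (tensor_dx jb jc (i, j) p).
- by move=> y; rewrite /tensor/= b0 mul0r.
Qed.

Lemma trace0_tensor_dy w w' (i j : nat) : trace0 l1 l2 w ->
  is_weak_deriv Om (0%N, 1%N) w w' ->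
  \int[leb2]_p ((w \_ Om) p * t (i, j.+1) p) = - \int[leb2]_p ((w' \_ Om) p * t (i, j) p).
Proof.
move=> [_ tw] ww'.
apply: (trace0_integration_by_parts l10 l20 e0 cvg_e mm (D := @dy R)) tw ww' => //.
- by move=> f sf; exact: (smooth_weak_deriv l10 l20 (0%N, 1%N)).
- by move=> x; exact: (cvg_pair cvg_id (cvg_cst 0)).
- exact: closure_Omega_bottom.
- exact: tensor_continuous.
- exact: tensor_continuous.
move=> f sf.
apply: (integration_by_parts_dy l10 l20 (smooth_continuous sf)
  (smooth_continuous (smooth_dy sf))).
- exact: tensor_continuous.
- exact: tensor_continuous.
- by move=> p; exact: smooth_is_derive_dy.
- by move=> p; exact: (tensor_dy jb jc (i, j) p).
- by move=> y; rewrite /tensor/= c0 mulr0.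
Qed.

Variables (k : nat) (u : R * R -> R).
Hypothesis uk : HGamma l1 l2 k u.

(** The order [n] varies in the induction: each step lowers the order of the kernel by one and
    raises that of [wd], whose trace vanishes as long as that order is less than [k]. *)
Lemma HGamma_tensor_dx (i j n : nat) : (n + i <= k)%N ->
  \int[leb2]_p ((wd Om (n, 0%N) u \_ Om) p * t (i, j) p) =
  (-1) ^+ i * \int[leb2]_p ((wd Om ((n + i)%N, 0%N) u \_ Om) p * t (0%N, j) p).
Proof.
case: uk => Hu Tu.
elim: i n => [|i IH] n nik; first by rewrite addn0 mul1r.
have nk : (n < k)%N by rewrite (leq_trans _ nik)// addnS ltnS leq_addr.
have tn : trace0 l1 l2 (wd Om (n, 0%N) u) by apply: Tu; rewrite /= addn0.
rewrite (trace0_tensor_dx (w' := wd Om (n.+1, 0%N) u) i j tn); last first.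
  by apply: wd_dx; apply: Hu; rewrite /= addn0// ltnW.
by rewrite IH ?addSnnS// exprS mulN1r mulNr.
Qed.

Lemma HGamma_tensor_dy (i j n : nat) : (i + (n + j) <= k)%N ->
  \int[leb2]_p ((wd Om (i, n) u \_ Om) p * t (0%N, j) p) =
  (-1) ^+ j * \int[leb2]_p ((wd Om (i, (n + j)%N) u \_ Om) p * t (0%N, 0%N) p).
Proof.
case: uk => Hu Tu.
elim: j n => [|j IH] n nik; first by rewrite addn0 mul1r.
have nk : (i + n < k)%N by rewrite (leq_trans _ nik)// addnS addnS ltnS addnA leq_addr.
rewrite (trace0_tensor_dy (w' := wd Om (i, n.+1) u) 0 j (Tu (i, n) nk)); last first.
  by apply: wd_dy; apply: Hu; rewrite /= ?addnS// ltnW.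
by rewrite IH ?addSnnS// exprS mulN1r mulNr.
Qed.

(** Derivatives in x go first, as [wd_dx] requires. The start of the chain is [wd] of order 0, which
    is equal to [u] only almost everywhere. *)
Lemma HGamma_tensor a : (a.1 + a.2 <= k)%N ->
  \int[leb2]_p ((u \_ Om) p * t a p) =
  (-1) ^+ (a.1 + a.2) * \int[leb2]_p ((wd Om a u \_ Om) p * t (0%N, 0%N) p).
Proof.
case: a => i j /= ijk; have ik : (0 + i <= k)%N by rewrite add0n (leq_trans _ ijk)// leq_addr.
have ijk' : (i + (0 + j) <= k)%N by rewrite add0n.
transitivity (\int[leb2]_p ((wd Om (0%N, 0%N) u \_ Om) p * t (i, j) p)); last first.
  by rewrite HGamma_tensor_dx// HGamma_tensor_dy// !add0n exprD mulrA.
case: uk => Hu _; have [v uv] := Hu (0%N, 0%N) (leq0n k).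
have su : square_integrable l1 l2 u by case/is_weak_derivP: uv.
have sw := @square_integrable_wd R l1 l2 l10 l20 (0%N, 0%N) u.
have ct : continuous (t (i, j)) by exact: tensor_continuous.
have u0 := is_weak_deriv00 su.
apply: Rintegral_restrict_ae => //; exact: weak_deriv_unique u0 (wdP u0).
Qed.

End tensor_test.
End HGamma.

Lemma exists_mollifiers (R : realType) : exists (e : nat -> R) (m : nat -> nat -> R -> R),
  [/\ forall n, 0 < e n, e n @[n --> \oo] --> 0 & forall n, mollifier (e n) (m n)].
Proof.
pose e n : R := n.+1%:R^-1.
have e0 n : 0 < e n by rewrite invr_gt0.
have mm n : {a | mollifier (e n) a}.
  by apply: cid; have [a [? ? ? ?]] := exists_mollifier (e0 n); exists a.
exists e, (fun n => projT1 (mm n)); split => // [|n]; first exact: cvg_harmonic.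
exact: projT2 (mm n).
Qed.

(** * Regularization by one-sided kernels *)

Section regularization.
Variable R : realType.
Local Notation T := (measurableTypeR R * measurableTypeR R)%type.
Local Notation leb := (@lebesgue_measure R).
Local Notation leb2 := (@plane_measure R).
Implicit Types (p q : R * R) (f g h v w : R * R -> R) (a b : nat * nat).
Variables l1 l2 : R.
Hypothesis l10 : 0 < l1.
Hypothesis l20 : 0 < l2.
Local Notation Om := (Omega l1 l2).
Variables (e : nat -> R) (m : nat -> nat -> R -> R).
Hypothesis e0 : forall n, 0 < e n.
Hypothesis cvg_e : e n @[n --> \oo] --> 0.
Hypothesis mm : forall n, mollifier (e n) (m n).

Lemma is_weak_deriv_ae a w w' v : square_integrable l1 l2 w' ->
  energy leb2 ((w \- w') \_ Om) = 0%E ->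
  is_weak_deriv Om a w v -> is_weak_deriv Om a w' v.
Proof.
move=> sw' ww' /is_weak_derivP[sw sv wv]; apply/is_weak_derivP; split => // f tf.
rewrite -wv//; symmetry; apply: Rintegral_restrict_ae => //.
by case: tf => sf _; apply/smooth_continuous/smooth_pd.
Qed.

(** Derivatives of [f] are weak derivatives of [w] too, so that 0 is a weak derivative of [f - w]
    for every order. *)
Lemma Hnorm_ae_eq0 f w : smooth f -> square_integrable l1 l2 w ->
  energy leb2 ((f \- w) \_ Om) = 0%E -> forall n, Hnorm Om n (f \- w) = 0%E.
Proof.
move=> sf sw fw n.
have lt_e (r : R) : 0 < r -> (Hnorm Om n (f \- w)%R < r%:E)%E.
  move=> r0; apply: Hnorm_lt => // a _.
  have fa := smooth_weak_deriv l10 l20 a sf.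
  have wa := is_weak_deriv_ae sw fw fa.
  have [_] := energy_wd_eq l10 l20 e0 cvg_e mm (is_weak_derivB l10 l20 fa wa).
  move=> /le_trans; apply.
  set z := (_ \- _); have -> : z \_ Om = fun=> 0.
    by apply/funext => p; rewrite patchE; case: ifP => // _; exact: subrr.
  rewrite /energy integral0_eq; first by rewrite mule0 lee_fin sqr_ge0.
  by move=> p _; rewrite expr0n.
apply/eqP; rewrite eq_le Hnorm_ge0 andbT.
by apply/lee_addgt0Pr => r r0; rewrite add0e ltW// lt_e.
Qed.

(** The constant sequence [f] is admissible in [is_trace], being at distance 0 from [w]. The case in
    view is a [w] chosen by [wd], equal to a classical derivative only almost everywhere. *)
Lemma is_trace_smooth0 f w (gam : R -> R * R) (I : set R) : smooth f ->
  (forall t, I t -> f (gam t) = 0) -> square_integrable l1 l2 w ->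
  energy leb2 ((f \- w) \_ Om) = 0%E -> is_trace Om gam I w (fun=> 0).
Proof.
move=> sf f0 sw fw.
have r0 : ((fun=> 0) : R -> R) \_ I = fun=> 0.
  by apply/funext => t; rewrite patchE; case: ifP.
split.
- move=> a _; exists (iter a.2 (@dy R) (iter a.1 (@dx R) f)).
  exact/(is_weak_deriv_ae sw fw)/smooth_weak_deriv.
- apply/L2P; rewrite r0; split; first exact: measurable_cst.
  by rewrite /energy integral0_eq// => t _; rewrite expr0n.
- exists (fun=> f); split.
  + by move=> _; exists f.
  + by rewrite Hnorm_ae_eq0//; exact: cvg_cst.
  + rewrite (_ : L2norm _ _ _ = 0%E); first exact: cvg_cst.
    rewrite /L2norm (_ : _ \_ _ = fun=> 0); first exact: Lnorm0.
    apply/funext => t; rewrite patchE; case: ifPn => //; rewrite inE => It.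
    by rewrite /= f0// subrr.
Qed.

Variables (k : nat) (u : R * R -> R).
Hypothesis uk : HGamma l1 l2 k u.

(** The second argument is an order of derivation, which falls on the kernel: this is the
    approximating function together with all its derivatives. *)
Definition regularization n := convolution (m n) (m n) leb2 (u \_ Om).

Lemma HGamma_square_integrable : square_integrable l1 l2 u.
Proof.
by case: uk => /(_ (0%N, 0%N) (leq0n k))[v /is_weak_derivP[]].
Qed.

Let iu : leb2.-integrable setT (EFin \o (u \_ Om)).
Proof.
apply: (integrable_Omega l10 l20 HGamma_square_integrable) => p pO.
by rewrite patchE memNset.
Qed.

Let jm n : jet (m n) := mollifier_jet (mm n).

Lemma regularization_smooth n a : smooth (regularization n a).
Proof.
apply: smooth_family => i; first exact: convolution_continuous.
  by move=> p; exact: convolution_dx.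
by move=> p; exact: convolution_dy.
Qed.

Lemma regularization_weak_deriv n a :
  is_weak_deriv Om a (regularization n (0%N, 0%N)) (regularization n a).
Proof.
have := smooth_weak_deriv l10 l20 a (regularization_smooth n (0%N, 0%N)).
congr (is_weak_deriv _ _ _ _).
have dxE i : iter i (@dx R) (regularization n (0%N, 0%N)) = regularization n (i, 0%N).
  elim: i => // i /= ->; apply: dx_family => j p.
  exact: convolution_dx.
case: a => i j /=; rewrite dxE; elim: j => // j /= ->.
apply: dy_family => l p; exact: convolution_dy.
Qed.

Lemma regularization_eq0 n a p : p.1 < e n \/ p.2 < e n -> regularization n a p = 0.
Proof.
move=> pe; rewrite /regularization /convolution /Rintegral -[RHS]/(fine 0%E).
congr fine; apply: integral0_eq => q _; congr EFin.
rewrite patchE; case: ifPn; rewrite ?mulr0// inE => -[/=].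
rewrite !in_itv/= => /andP[q1 _] /andP[q2 _]; apply/eqP; rewrite mulf_eq0.
apply/orP; left; apply/negP => /negP; rewrite mulf_eq0 negb_or => /andP[].
by move=> /(mollifier_support (mm n))/= ? /(mollifier_support (mm n))/= ?; case: pe; lra.
Qed.

(** As a function of the integration variable, the differentiated kernel is [(-1) ^ |a|] times a
    derivative of the reflected kernel; moving the derivatives to [u] by [HGamma_tensor] gives the
    same sign again. *)
Lemma regularization_average n a p : (a.1 + a.2 <= k)%N -> Om p ->
  regularization n a p = average leb2 (product_kernel (m n)) (wd Om a u \_ Om) p.
Proof.
move=> ak [/=]; rewrite !in_itv/= => /andP[p1 pl1] /andP[p2 pl2].
pose refl (x : R) i (y : R) := (-1) ^+ i * m n i (x - y).
have m0 i x : x <= 0 -> m n i x = 0.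
  move=> x0; apply/eqP/negP => /negP/(mollifier_support (mm n)).
  by have := e0 n; lra.
have := @HGamma_tensor R l1 l2 l10 l20 e m e0 cvg_e mm (refl p.1) (refl p.2).
move=> /(_ (jet_reflect _ (jm n)) (jet_reflect _ (jm n))).
(* For [p] in Omega, [p.1 - l1] is negative, whereas the support of [m n i] starts at [e n > 0]. *)
have r1 i : refl p.1 i l1 = 0 by rewrite /refl m0 ?mulr0// subr_le0 ltW.
have r2 i : refl p.2 i l2 = 0 by rewrite /refl m0 ?mulr0// subr_le0 ltW.
move=> /(_ r1 r2 k u uk a ak).
set X := Rintegral _ _ _; set Y := Rintegral _ _ _ => XY.
have -> : regularization n a p = (-1) ^+ (a.1 + a.2) * X.
  rewrite /regularization /convolution -RintegralZl//; last first.
    apply: integrable_restrictM => //; first exact: HGamma_square_integrable.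
    by apply: tensor_continuous; exact: jet_reflect.
  apply: eq_Rintegral => q _; rewrite /tensor/= /refl exprD.
  have s i : (-1) ^+ i * (-1) ^+ i = 1 :> R by rewrite -expr2 sqrr_sign.
  have := s a.1; have := s a.2; set x := _ ^+ a.2; set y := _ ^+ a.1 => xx yy.
  rewrite [RHS](_ : _ = (x * x) * (y * y) * (m n a.1 (p.1 - q.1) *
    m n a.2 (p.2 - q.2) * (u \_ Om) q)); last by ring.
  by rewrite xx yy !mul1r.
rewrite XY mulrA -expr2 sqrr_sign mul1r.
apply: eq_Rintegral => q _.
by rewrite /product_kernel /tensor/= /refl !expr0 !mul1r mulrC.
Qed.

Lemma regularization_VGamma n : VGamma l1 l2 (regularization n (0%N, 0%N)).
Proof.
split; first by exists (regularization n (0%N, 0%N)) => //; exact: regularization_smooth.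
exists (fst @^-1` [set x | x < e n] `|` snd @^-1` [set y | y < e n]); split.
- apply: openU.
    by apply: open_comp (@open_lt _ (e n)) => p _; exact: cvg_fst.
  by apply: open_comp (@open_lt _ (e n)) => p _; exact: cvg_snd.
- by move=> p [_ [] p0]; [left|right]; rewrite /= p0.
- by move=> p pU _; exact: regularization_eq0.
Qed.

(** Every classical derivative vanishes on Gamma, and [wd] equals it almost everywhere, which
    suffices for zero traces by [is_trace_smooth0]. *)
Lemma regularization_HGamma n : HGamma l1 l2 k (regularization n (0%N, 0%N)).
Proof.
split=> [a _|a _]; first by exists (regularization n a); exact: regularization_weak_deriv.
have wn := regularization_weak_deriv n a.
have sw : square_integrable l1 l2 (wd Om a (regularization n (0%N, 0%N))).
  exact: square_integrable_wd.
have eq0 := weak_deriv_unique l10 l20 e0 cvg_e mm wn (wdP wn).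
have sn := regularization_smooth n a.
split; apply: is_trace_smooth0 sn _ sw eq0 => t _; apply: regularization_eq0.
  by left.
by right.
Qed.

Lemma energy_wd_regularization n a : (a.1 + a.2 <= k)%N ->
  (energy leb2 (wd Om a (u \- regularization n (0%N, 0%N))%R \_ Om) <=
   2%:E * energy leb2 (fun p => average leb2 (product_kernel (m n)) (wd Om a u \_ Om) p -
     (wd Om a u \_ Om) p)%R)%E.
Proof.
move=> ak; have [v /wdP ua] : exists v, is_weak_deriv Om a u v by case: uk => + _; exact.
have wn := regularization_weak_deriv n a.
have [_] := energy_wd_eq l10 l20 e0 cvg_e mm (is_weak_derivB l10 l20 ua wn).
move=> /le_trans; apply; apply: lee_wpmul2l => //.
have sw := square_integrable_wd l10 l20 a u.
have aK := kernel_averaging (mm n).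
have sa := sqint_average aK sw.
apply: ge0_le_integral => //.
- by move=> p _; rewrite lee_fin sqr_ge0.
- apply: measurable_sqr; rewrite restrictB; apply: measurable_funB; first by case: sw.
  have cn := smooth_continuous (regularization_smooth n a).
  exact: measurable_restrict_Omega cn.
- by apply: measurable_sqr; apply: measurable_funB; [case: sa|case: sw].
(* Outside of Omega the left-hand side is 0, but the averages need not be: this is an inequality,
   not an equality. *)
move=> p _; rewrite lee_fin !patchE; case: ifPn; last by rewrite expr0n sqr_ge0.
by rewrite inE => Op; rewrite /= regularization_average// -sqrrN opprB.
Qed.

Lemma regularization_cvg (r : R) : 0 < r -> \forall n \near \oo,
  (Hnorm Om k (u \- regularization n (0%N, 0%N))%R < r%:E)%E.
Proof.
(* The threshold of [Hnorm_lt], halved to absorb the factor 2 of [energy_wd_regularization]. *)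
move=> r0; pose d := (r / (2 * k.+1%:R)) ^+ 2 / 2.
have d0 : 0 < d by rewrite divr_gt0// exprn_gt0// divr_gt0// mulr_gt0.
(* One rank for finitely many orders. The pairs with [i + j > k] are included: [wd] is square
   integrable for them as well. *)
have near_d : \forall n \near \oo, forall ij : 'I_k.+1 * 'I_k.+1,
    (energy leb2 (fun p => average leb2 (product_kernel (m n))
      (wd Om (nat_of_ord ij.1, nat_of_ord ij.2) u \_ Om) p -
      (wd Om (nat_of_ord ij.1, nat_of_ord ij.2) u \_ Om) p)%R <= d%:E)%E.
  apply: filter_forall => -[i j] /=.
  have sw := square_integrable_wd l10 l20 (nat_of_ord i, nat_of_ord j) u.
  have [|_] := @average_cvg_plane R e m e0 cvg_e mm l1 l2 _ sw; last exact.
  by move=> p pO; rewrite patchE memNset.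
apply: filterS near_d => n nd; apply: Hnorm_lt => // -[i j] /= ijk.
apply: le_trans (@energy_wd_regularization n (i, j) ijk) _.
have ik : (i < k.+1)%N by rewrite ltnS (leq_trans (leq_addr _ _) ijk).
have jk : (j < k.+1)%N by rewrite ltnS (leq_trans (leq_addl _ _) ijk).
apply: (@le_trans _ _ (2%:E * d%:E)%E).
  by apply: lee_wpmul2l => //; exact: (nd (Ordinal ik, Ordinal jk)).
by rewrite -EFinM lee_fin mulrCA divff ?mulr1.
Qed.

End regularization.

Theorem theorem2p1 (R : realType) (L1 L2 : R) (hL1 : 0 < L1) (hL2 : 0 < L2)
    (m : nat) :
  dense_subset (Hnorm (Omega L1 L2) m)
    (VGamma L1 L2 `&` HGamma L1 L2 m) (HGamma L1 L2 m).
Proof.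
split=> [v []//|u um r r0].
have [e [k [e0 cvg_e mk]]] := exists_mollifiers R.
have [n un] : exists n, (Hnorm (Omega L1 L2) m (u \- regularization L1 L2 k u n (0%N, 0%N))%R < r%:E)%E.
  exact: filter_ex (regularization_cvg hL1 hL2 e0 cvg_e mk um r0).
exists (regularization L1 L2 k u n (0%N, 0%N)); last exact: un.
split.
  exact: (regularization_VGamma hL1 hL2 e0 mk um).
exact: (regularization_HGamma hL1 hL2 e0 cvg_e mk um).
Qed.
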